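(* Let $(\mathbb{E},\circ,\bullet)$ be a Euclidean Jordan algebra of dimension $n$, let $m\ge 1$ be an integer, fix an orthonormal basis $v_1,\dots,v_n$ of $\mathbb{E}$ and let $\phi:\mathbb{E}\to\mathbb{R}^n$ be the associated coordinate isometry. Let $\psi:\mathcal{S}^{n,m}(\mathbb{E})\to H^{n,m}$ be the linear isomorphism $\psi(\mathcal{A})(\boldsymbol{x}) = \langle \mathcal{A},\phi^{-1}(\boldsymbol{x})^{\otimes m}\rangle$. Then: (i) $\psi(\mathcal{COP}^{n,m}(\mathbb{E}_+)) = \widetilde{\mathcal{COP}}^{n,m}(\phi(\mathbb{E}_+))$. (ii) $\psi(\mathcal{K}_{\mathrm{NN},r}^{n,m}(\mathbb{E}_+)) = \widetilde{\mathcal{K}}_{\mathrm{NN},r}^{n,m}(\phi(\mathbb{E}_+))$ for every $r\in\mathbb{N}$. (iii) Each $\mathcal{K}_{\mathrm{NN},r}^{n,m}(\mathbb{E}_+)$ ($r\in\mathbb{N}$) is a closed convex cone; moreover $\mathcal{K}_{\mathrm{NN},r}^{n,m}(\mathbb{E}_+)\subseteq \mathcal{K}_{\mathrm{NN},r+1}^{n,m}(\mathbb{E}_+)\subseteq \mathcal{COP}^{n,m}(\mathbb{E}_+)$ for all $r\in\mathbb{N}$, and $\operatorname{int}\mathcal{COP}^{n,m}(\mathbb{E}_+)\subseteq\bigcup_{r=0}^\infty \mathcal{K}_{\mathrm{NN},r}^{n,m}(\mathbb{E}_+)$.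
   Context: $\mathbb{N}$ is the set of nonnegative integers. A Euclidean Jordan algebra $(\mathbb{E},\circ,\bullet)$ is a finite-dimensional real vector space with a bilinear product $\circ$ such that $x\circ y=y\circ x$ and $x\circ((x\circ x)\circ y)=(x\circ x)\circ(x\circ y)$, having an identity element for $\circ$, together with a fixed inner product $\bullet$ satisfying $(x\circ y)\bullet z=x\bullet(y\circ z)$. Its symmetric cone is $\mathbb{E}_+=\{x\circ x\mid x\in\mathbb{E}\}$. A cone is a nonempty set closed under multiplication by positive scalars. For an $n$-dimensional real inner product space $\mathbb{V}$, $\mathbb{V}^{\otimes m}$ carries the induced inner product $\langle x_1\otimes\cdots\otimes x_m,y_1\otimes\cdots\otimes y_m\rangle=\prod_i (x_i,y_i)$; $\mathcal{S}^{n,m}(\mathbb{V})\subseteq\mathbb{V}^{\otimes m}$ is the subspace of symmetric tensors (invariant under all permutations of the $m$ factors); $x^{\otimes m}=x\otimes\cdots\otimes x$. $\mathscr{S}$ is the symmetrization map on $\mathbb{V}^{\otimes m}$, i.e. the average over all permutations of the tensor factors. $H^{n,m}$ is the space of real homogeneous polynomials of degree $m$ in $n$ variables, and $\Sigma^{n,2m}=\operatorname{conv}\{\theta^2\mid\theta\in H^{n,m}\}$. $\mathcal{COP}^{n,m}(\mathbb{E}_+)=\{\mathcal{A}\in\mathcal{S}^{n,m}(\mathbb{E})\mid\langle\mathcal{A},x^{\otimes m}\rangle\ge0\ \forall x\in\mathbb{E}_+\}$. $\mathrm{SOS}^{n,2k}(\mathbb{E})=\operatorname{conv}\{\mathscr{S}(\mathcal{B}\otimes\mathcal{B})\mid\mathcal{B}\in\mathcal{S}^{n,k}(\mathbb{E})\}\subseteq\mathcal{S}^{n,2k}(\mathbb{E})$.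 For $\mathcal{A}\in\mathcal{S}^{n,m}(\mathbb{E})$ and $r\in\mathbb{N}$, $\mathcal{A}^{(r)}$ is the unique element of $\mathcal{S}^{n,2(r+m)}(\mathbb{E})$ with $(x\bullet x)^r\langle\mathcal{A},(x\circ x)^{\otimes m}\rangle=\langle\mathcal{A}^{(r)},x^{\otimes 2(r+m)}\rangle$ for all $x\in\mathbb{E}$. Then $\mathcal{K}_{\mathrm{NN},r}^{n,m}(\mathbb{E}_+)=\{\mathcal{A}\in\mathcal{S}^{n,m}(\mathbb{E})\mid\mathcal{A}^{(r)}\in\mathrm{SOS}^{n,2(r+m)}(\mathbb{E})\}$. On $\mathbb{R}^n$ put $\boldsymbol{x}\lozenge\boldsymbol{y}=\phi(\phi^{-1}(\boldsymbol{x})\circ\phi^{-1}(\boldsymbol{y}))$. Then $\widetilde{\mathcal{COP}}^{n,m}(\phi(\mathbb{E}_+))=\{\theta\in H^{n,m}\mid\theta(\boldsymbol{x})\ge0\ \forall\boldsymbol{x}\in\phi(\mathbb{E}_+)\}$ and $\widetilde{\mathcal{K}}_{\mathrm{NN},r}^{n,m}(\phi(\mathbb{E}_+))=\{\theta\in H^{n,m}\mid(\boldsymbol{x}^\top\boldsymbol{x})^r\theta(\boldsymbol{x}\lozenge\boldsymbol{x})\in\Sigma^{n,2(r+m)}\}$. *)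

(* Defs.v *)
From HB Require Import structures.
From mathcomp Require Import all_boot all_order all_fingroup all_algebra.
From mathcomp Require Import all_classical all_reals all_analysis.
From mathcomp Require mpoly.
(* The notations of mpoly clash with those of analysis. *)
Import -(notations) mpoly.

Set Implicit Arguments.
Unset Strict Implicit.
Unset Printing Implicit Defensive.

Import Order.TTheory GRing.Theory Num.Theory.
Import numFieldNormedType.Exports.

Local Open Scope classical_set_scope.
Local Open Scope ring_scope.

Record euclideanJordan (R : realType) (E : vectType R) := EuclideanJordan {
  jmul : {bilinear E -> E -> E};
  jdot : {dot E for idfun};
  jone : E;
  jmulC : forall x y, jmul x y = jmul y x;
  jmul_jordan : forall x y,
    jmul x (jmul (jmul x x) y) = jmul (jmul x x) (jmul x y);
  jmul1 : forall x, jmul jone x = x;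
  jdotA : forall x y z, jdot (jmul x y) z = jdot x (jmul y z) }.

Definition sym_cone (R : realType) (E : vectType R) (J : euclideanJordan E) :
  set E := range (fun x => jmul J x x).

Definition orthonormal_basis (R : realType) (E : vectType R)
    (J : euclideanJordan E) (v : (\dim {:E}).-tuple E) : Prop :=
  basis_of {:E} v /\
  forall i j, jdot J (tnth v i) (tnth v j) = (i == j)%:R.

Section Convexity.
Variables (R : realType) (V : lmodType R).

Definition convex_hull (S : set V) : set V :=
  smallest (@convex_set R V) S.

Definition cone (S : set V) : Prop :=
  S !=set0 /\ forall (c : R) x, 0 < c -> S x -> S (c *: x).

End Convexity.

(** A tensor in the [m]-th tensor power of [E] is given by its coordinates in
    the basis of tensors b_{f 0} ⊗ ... ⊗ b_{f (m-1)}, where b is the library's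
    basis [vbasis {:E}], which need not be orthonormal.  The coordinates are
    stored in a row vector, so that tensors carry the topology of a
    finite-dimensional normed space. *)
Section Tensors.
Variables (R : realType) (E : vectType R) (J : euclideanJordan E).
Local Notation b := (vbasis {:E}).

Definition tindex (m : nat) := {ffun 'I_m -> 'I_(\dim {:E})}.

Definition tensor (m : nat) := 'rV[R]_#|{: tindex m}|.

Definition mktensor m (F : tindex m -> R) : tensor m :=
  \row_k F (enum_val k).

Definition tcoef m (A : tensor m) (f : tindex m) : R := A 0 (enum_rank f).

Definition ptens m (x : 'I_m -> E) : tensor m :=
  mktensor (fun f => \prod_i coord b (f i) (x i)).

Definition tpow m (x : E) : tensor m := ptens (fun _ => x).

Definition tdot m (A B : tensor m) : R :=
  \sum_(f : tindex m) \sum_(g : tindex m)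
    tcoef A f * tcoef B g * \prod_i jdot J (tnth b (f i)) (tnth b (g i)).

Definition tprod m k (A : tensor m) (B : tensor k) : tensor (m + k) :=
  mktensor (fun f : tindex (m + k) =>
    tcoef A [ffun i => f (lshift k i)] * tcoef B [ffun i => f (rshift m i)]).

Definition tpermute m (s : 'S_m) (A : tensor m) : tensor m :=
  mktensor (fun f : tindex m => tcoef A [ffun i => f (s i)]).

Definition symtensor m : set (tensor m) :=
  [set A | forall s : 'S_m, tpermute s A = A].

Definition symmetrize m (A : tensor m) : tensor m :=
  (m`!%:R)^-1 *: \sum_(s : 'S_m) tpermute s A.

Lemma tcoefK m (F : tindex m -> R) f : tcoef (mktensor F) f = F f.
Proof. by rewrite /tcoef mxE enum_rankK. Qed.

Lemma tensorP m (A B : tensor m) : (forall f, tcoef A f = tcoef B f) -> A = B.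
Proof.
by move=> AB; apply/rowP => k; rewrite -(enum_valK k); exact: AB.
Qed.

Lemma ptens_linear m (i : 'I_m) (x y z : 'I_m -> E) (c : R) :
    x i = c *: y i + z i ->
    (forall j, j != i -> x j = y j) -> (forall j, j != i -> x j = z j) ->
  ptens x = c *: ptens y + ptens z.
Proof.
move=> xi xy xz; apply/rowP => k; rewrite !mxE.
pose D u := \prod_(j | j != i) coord b (enum_val k j) (u j).
have DE u : \prod_j coord b (enum_val k j) (u j) =
    coord b (enum_val k i) (u i) * D u by rewrite (bigD1 i).
rewrite !DE xi.
rewrite (linearP (coord b _)) mulrDl -mulrA; congr (_ * (_ * _) + _ * _).
  by apply: eq_bigr => j /xy ->.
by apply: eq_bigr => j /xz ->.
Qed.

Lemma coord_vbasis_tnth i j : coord b i (tnth b j) = (i == j)%:R.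
Proof. by rewrite (tnth_nth 0) coord_free ?(basis_free (vbasisP _)) // eq_sym. Qed.

Lemma ptens_span m (A : tensor m) :
  A = \sum_(f : tindex m) tcoef A f *: ptens (fun i => tnth b (f i)).
Proof.
apply: tensorP => g; rewrite [in RHS]/tcoef summxE (bigD1 g) //= big1.
  rewrite !mxE enum_rankK big1 ?mulr1 ?addr0 // => i _.
  by rewrite coord_vbasis_tnth eqxx.
move=> f fg; rewrite !mxE enum_rankK.
have /existsP[i gfi] : [exists i, g i != f i].
  apply: contraR fg; rewrite negb_exists => /forallP h.
  by apply/eqP/ffunP => i; have := h i; rewrite negbK => /eqP.
by rewrite (bigD1 i) //= coord_vbasis_tnth (negPf gfi) mul0r mulr0.
Qed.

Lemma tdot_ptens m (x y : 'I_m -> E) :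
  tdot (ptens x) (ptens y) = \prod_i jdot J (x i) (y i).
Proof.
transitivity (\prod_i \sum_j \sum_k
   coord b j (x i) * coord b k (y i) * jdot J (tnth b j) (tnth b k)).
  rewrite bigA_distr_bigA; apply: eq_bigr => f _.
  rewrite bigA_distr_bigA; apply: eq_bigr => g _.
  by rewrite !tcoefK !big_split.
apply: eq_bigr => i _.
have bE z : z = \sum_j coord b j z *: tnth b j.
  rewrite [LHS](coord_vbasis (memvf z)).
  by apply: eq_bigr => j _; rewrite (tnth_nth 0).
rewrite [in RHS](bE (x i)) linear_sumlz; apply: eq_bigr => j _.
rewrite linearZl_LR [in RHS](bE (y i)) linear_sumr /= mulr_sumr.
by apply: eq_bigr => k _; rewrite linearZr_LR /= mulrA.
Qed.

Lemma tpermute_ptens m (s : 'S_m) (x : 'I_m -> E) :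
  tpermute s (ptens x) = ptens (fun i => x ((s^-1)%g i)).
Proof.
apply: tensorP => f; rewrite !tcoefK (reindex_inj (@perm_inj _ s^-1%g)) /=.
by apply: eq_bigr => i _; rewrite ffunE permKV.
Qed.

Lemma tprod_ptens m k (x : 'I_(m + k) -> E) :
  tprod (ptens (fun i => x (lshift k i))) (ptens (fun i => x (rshift m i))) =
  ptens x.
Proof.
apply: tensorP => f; rewrite !tcoefK big_split_ord /=.
by congr (_ * _); apply: eq_bigr => i _; rewrite ffunE.
Qed.

End Tensors.

Section Cones.
Variables (R : realType) (E : vectType R) (J : euclideanJordan E).

Definition COP (m : nat) : set (tensor E m) :=
  [set A | symtensor A /\
    forall x, sym_cone J x -> 0 <= tdot J A (tpow m x)].

(** [SOS k] is the set of sums of squares of order 2k; the order is written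
    [k + k], as it is the order of B ⊗ B. *)
Definition SOS (k : nat) : set (tensor E (k + k)) :=
  convex_hull [set symmetrize (tprod B B) | B in @symtensor R E k].

Definition lift_spec (m r : nat) (A : tensor E m)
    (B : tensor E ((r + m) + (r + m))) : Prop :=
  symtensor B /\
  forall x, jdot J x x ^+ r * tdot J A (tpow m (jmul J x x)) =
            tdot J B (tpow _ x).

(** Exactly one tensor satisfies [lift_spec A], since symmetric tensors
    correspond bijectively to homogeneous polynomials; the default value 0 of
    [xget] is thus irrelevant. *)
Definition lift_tensor (m r : nat) (A : tensor E m) :
    tensor E ((r + m) + (r + m)) :=
  xget 0 (lift_spec A).

Definition KNN (m r : nat) : set (tensor E m) :=
  [set A | symtensor A /\ @SOS (r + m) (lift_tensor r A)].

End Cones.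

Arguments COP {R E} J m.
Arguments SOS {R} E k.
Arguments KNN {R E} J m r.

(** Topological notions about sets of symmetric tensors are relative to the
    space of symmetric tensors, not to the whole tensor power. *)
Definition symspace (R : realType) (E : vectType R) (m : nat) :=
  subspace (@symtensor R E m).

(** Over an infinite field a polynomial is identified with the polynomial
    function that it defines. *)
Definition hpoly (R : realType) (n m : nat) : set ('rV[R]_n -> R) :=
  [set theta : 'rV[R]_n -> R | exists p : mpoly n R,
    p \is ishomog1 m mdeg /\
    forall x : 'rV[R]_n, theta x = meval (fun i => x 0 i) p].

(** Sums of squares of degree 2k. *)
Definition sospoly (R : realType) (n k : nat) : set ('rV[R]_n -> R) :=
  convex_hull [set (fun x => theta x ^+ 2) | theta in @hpoly R n k].

Section Coordinates.
Variables (R : realType) (E : vectType R) (J : euclideanJordan E).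
Local Notation n := (\dim {:E}).
Variable v : n.-tuple E.

Local Notation phi := (passmx.rVof v).
Local Notation phi_inv := (passmx.vecof v).

Definition psi (m : nat) (A : tensor E m) : 'rV[R]_n -> R :=
  fun x => tdot J A (tpow m (phi_inv x)).

Definition lozenge (x y : 'rV[R]_n) : 'rV[R]_n :=
  phi (jmul J (phi_inv x) (phi_inv y)).

Definition COPpoly (m : nat) : set ('rV[R]_n -> R) :=
  [set theta | hpoly m theta /\
    forall x, (phi @` sym_cone J) x -> 0 <= theta x].

Definition KNNpoly (m r : nat) : set ('rV[R]_n -> R) :=
  [set theta | hpoly m theta /\
    @sospoly R n (r + m)
      (fun x => (x *m x^T) 0 0 ^+ r * theta (lozenge x x))].

End Coordinates.

Arguments psi {R E} J v m A.

(* Main.v *)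
(** Coordinates with respect to an orthonormal basis turn symmetric tensors
    into homogeneous polynomials (injectively, by polarization), squares of
    tensors into squares of polynomials, and the defining condition of the r-th
    cone into: |x|^(2r) p is a sum of squares, where p(x) = theta(x o x).
    Closedness holds because, by conic Caratheodory, a bounded number of squares
    suffices, and polarization bounds each of them by the values of the sum.  If
    A is interior to the copositive cone, subtracting a small multiple of the
    m-th tensor power of the identity, for which p is |x|^(2m), shows that
    p > 0 away from 0; the last inclusion is then Reznick's theorem on uniform
    denominators, deduced here from Polya's theorem. *)
Require Import Defs.
From mathcomp Require Import all_boot all_order all_fingroup all_algebra.
From mathcomp Require Import all_classical all_reals all_analysis.
From mathcomp Require mpoly.
Import -(notations) mpoly.
From mathcomp Require Import ring lra zify.

Set Implicit Arguments.
Unset Strict Implicit.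
Unset Printing Implicit Defensive.

Import Order.TTheory GRing.Theory Num.Theory.
Import numFieldNormedType.Exports.

Local Open Scope classical_set_scope.
Local Open Scope ring_scope.

(** Forms and tensors share one encoding: coefficients indexed by words, that is, by maps from
    positions to letters. A polynomial has many such families, but products become concatenations of
    words and no multinomial coefficient arises; Polya's argument is then an average over maps
    between positions. The coordinates of a tensor are of this kind too, but refer to [vbasis],
    which need not be orthonormal, whereas [psi] uses [v]; the dual basis of [vbasis], expanded in
    [v], links the two. Polya's theorem concerns nonnegative variables, while p has variables of any
    sign. The squares of the x_i alone would not do, since p contains mixed products x_i x_j; the
    squares of all x_i + x_j and x_i - x_j recover these products, and a monomial in them is again a
    square. *)

(** For N > 0, division by N^(d+1) bounds the proportion of non-injective maps from d points to N
    points by d^2/N. Going from d to d + 1 costs at most d/N, the chance that the new point hits an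
    earlier value, and d^2 + d <= (d + 1)^2. *)
Lemma expn_ffact_leq N d : (N ^ d * N <= N ^_ d * N + d ^ 2 * N ^ d)%N.
Proof.
elim: d => [|d IH]; first by rewrite expn0 ffactn0; lia.
have fd : (N ^_ d <= N ^ d)%N.
  by elim: d {IH} => [|d IH]; rewrite ?ffactn0 // ffactnSr expnSr leq_mul ?leq_subr.
rewrite ffactnSr expnSr; move: (N ^_ d)%N (N ^ d)%N IH fd => x y.
case: (leqP d N) => [/subnK <-|]; last by nia.
by move: (N - d)%N => k; nia.
Qed.

(** * Polya's theorem for forms with coefficients on words *)

Section WordForms.
Variables (R : realType) (I : finType).

Definition wcomp d N (w : {ffun 'I_N -> I}) (g : {ffun 'I_d -> 'I_N}) :
  {ffun 'I_d -> I} := [ffun t => w (g t)].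

Definition wordsum d (a : {ffun 'I_d -> I} -> R) (y : I -> R) : R :=
  \sum_f a f * \prod_t y (f t).

(** A word consists of its letters on the image of [g], which alone determine the coefficient, and
    of N - d free letters, each of which contributes a factor [\sum_i y i]. *)
Lemma wordsum_injection d N (a : {ffun 'I_d -> I} -> R) (y : I -> R)
    (g : {ffun 'I_d -> 'I_N}) : injective g ->
  wordsum (fun w => a (wcomp w g)) y = (\sum_i y i) ^+ (N - d) * wordsum a y.
Proof.
move=> gI; rewrite /wordsum mulr_sumr.
rewrite (partition_big (fun w => wcomp w g) predT) //=.
apply: eq_bigr => f _.
rewrite (eq_bigr (fun w : {ffun 'I_N -> I} => a f * \prod_t y (w t))); last first.
  by move=> w /eqP ->.
rewrite -mulr_sumr mulrCA; congr (_ * _).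
(* [Q t j] allows the letter j at position t: it forces [f s] at [g s] and nothing elsewhere. The
   words above [f] thus form a product family, over which the sum of products factors. *)
pose Q t j := [forall s, (g s == t) ==> (f s == j)].
transitivity (\sum_(w in family Q) \prod_t y (w t)).
  apply: eq_bigl => w; apply/eqP/familyP => [wf t|wQ].
    by apply/forallP => s; apply/implyP => /eqP <-; rewrite -wf ffunE.
  by apply/ffunP => s; have /forallP/(_ s) := wQ (g s); rewrite eqxx ffunE => /eqP.
rewrite -(bigA_distr_big_dep _ (fun _ j => y j)).
rewrite (bigID [in g @: 'I_d]) /= mulrC; congr (_ * _).
  rewrite (eq_bigr (fun=> \sum_i y i)) => [|t tg].
    rewrite prodr_const; congr (_ ^+ _).
    apply: (canRL (addKn d)); have := cardC [in g @: 'I_d].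
    rewrite card_imset // !card_ord => cE; exact: cE.
  apply: eq_bigl => j; apply/forallP => s; apply/implyP => /eqP gs.
  by rewrite -gs imset_f in tg.
rewrite big_imset /=; last by move=> s t _ _; exact: gI.
apply: eq_bigr => s _; rewrite (big_pred1 (f s)) // => j.
apply/forallP/eqP => [/(_ s)|-> t]; first by rewrite eqxx => /eqP.
by apply/implyP => /eqP/gI ->.
Qed.

(** With c = 1/N the arguments are the letter frequencies of [w]. Expanding the product of the sums
    over k picks a position [g t] for each factor, and only the word [wcomp w g] survives. *)
Lemma wordsum_frequency d N (a : {ffun 'I_d -> I} -> R) (w : {ffun 'I_N -> I})
    (c : R) :
  wordsum a (fun j => \sum_k c * (w k == j)%:R) =
  c ^+ d * \sum_(g : {ffun 'I_d -> 'I_N}) a (wcomp w g).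
Proof.
rewrite /wordsum.
under eq_bigr => f _ do rewrite bigA_distr_bigA mulr_sumr.
rewrite exchange_big /= mulr_sumr; apply: eq_bigr => g _.
rewrite (bigD1 (wcomp w g)) //= [X in _ + X]big1 => [|f fg].
  rewrite addr0 mulrC; congr (_ * _).
  rewrite (eq_bigr (fun=> c)) ?prodr_const ?card_ord // => t _.
  by rewrite ffunE eqxx mulr1.
have [t tfg] : exists t, w (g t) != f t.
  apply/existsP; apply: contraR fg; rewrite negb_exists => /forallP h.
  by apply/eqP/ffunP => t; have := h t; rewrite ffunE negbK => /eqP.
by rewrite (bigD1 t) //= (negPf tfg) mulr0 mul0r mulr0.
Qed.

(* The coefficient of a word [w] in (sum y)^r * F(y), symmetrized over
   positions, is the average of [a (w o g)] over injections [g].  The average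
   over all maps [g] is the value of F at the letter frequencies of [w], and
   at most a fraction d^2/N of all maps fails to be injective, N = r + d. *)
Lemma polya d (a : {ffun 'I_d -> I} -> R) (mu : R) : 0 < mu ->
  (forall y : I -> R, (forall i, 0 <= y i) -> \sum_i y i = 1 -> mu <= wordsum a y) ->
  exists r (b : {ffun 'I_(r + d) -> I} -> R), (forall w, 0 <= b w) /\
    forall y : I -> R, (\sum_i y i) ^+ r * wordsum a y = wordsum b y.
Proof.
move=> mu0 amu; pose M : R := \sum_f `|a f|.
have M0 : 0 <= M by apply: sumr_ge0.
have aM f : a f <= M.
  apply: (le_trans (ler_norm _)); rewrite /M (bigD1 f) //= lerDl.
  by apply: sumr_ge0.
(* With N = r + d this gives d^2 M <= N mu, so the non-injective maps, each contributing at most M,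
   cannot outweigh the total N^d mu. The successor also keeps N positive when d = 0. *)
pose r := (Num.truncn ((d ^ 2)%:R * M / mu)).+1.
pose N := (r + d)%N.
have N0 : 0 < N%:R :> R by rewrite ltr0n.
have NM : (d ^ 2)%:R * M <= N%:R * mu.
  rewrite -ler_pdivrMr //; apply: (le_trans (ltW (truncnS_gt _))).
  by rewrite ler_nat leq_addr.
pose inj := [set g : {ffun 'I_d -> 'I_N} | injectiveb g]%SET.
have card_inj : #|inj| = (N ^_ d)%N by rewrite card_inj_ffuns !card_ord.
have inj0 : 0 < #|inj|%:R :> R by rewrite card_inj ltr0n ffact_gt0 leq_addl.
exists r, (fun w => #|inj|%:R^-1 * \sum_(g in inj) a (wcomp w g)); split=> [w|y].
  apply: mulr_ge0; first by rewrite invr_ge0 ltW.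
  have : N%:R ^+ d * mu <= \sum_(g : {ffun 'I_d -> 'I_N}) a (wcomp w g).
    have := wordsum_frequency a w N%:R^-1.
    move/(congr1 (fun z => N%:R ^+ d * z)).
    rewrite mulrA -exprMn mulfV ?gt_eqF // expr1n mul1r => <-.
    rewrite ler_wpM2l ?exprn_ge0 // amu // => [i|].
      by apply: sumr_ge0 => k _; rewrite mulr_ge0 // invr_ge0 ltW.
    rewrite exchange_big /= (eq_bigr (fun=> N%:R^-1)) => [|k _].
      by rewrite sumr_const card_ord -[LHS]mulr_natl mulfV ?gt_eqF.
    rewrite -mulr_sumr (bigD1 (w k)) //= eqxx big1 ?addr0 ?mulr1 // => i.
    by rewrite eq_sym => /negPf ->.
  rewrite (bigID [in inj]) /= => sum_ge.
  have : \sum_(g | g \notin inj) a (wcomp w g) <= (N ^ d - N ^_ d)%:R * M.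
    rewrite -card_inj.
    have -> : (N ^ d - #|inj| = #|~: inj|)%N.
      by rewrite [RHS]cardsCs finset.setCK card_ffun !card_ord.
    rewrite mulr_natl -sumr_const.
    rewrite [leRHS](eq_bigl (fun g => g \notin inj)) => [|g]; last by rewrite inE.
    by apply: ler_sum.
  move=> noninj_le; have := expn_ffact_leq N d.
  have fd : (N ^_ d <= N ^ d)%N.
    have := max_card [in inj]; rewrite card_inj card_ffun !card_ord.
    by [].
  rewrite -(ler_nat R) natrD !(natrM _ _ N) (natrM _ (d ^ 2)%N).
  move: sum_ge noninj_le NM.
  rewrite natrB // -natrX; set X := \sum_(_ in _) _; set Y := \sum_(_ | _) _.
  have : 0 < (N ^ d)%:R :> R by rewrite natrX exprn_gt0.
  move: (N ^ d)%:R (N ^_ d)%:R (d ^ 2)%:R => p q e p0 pX Yp eM pq.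
  have XNp : N%:R * ((p * mu) - (p - q) * M) <= N%:R * X.
    by rewrite ler_wpM2l ?(ltW N0) //; lra.
  rewrite -(pmulr_rge0 _ N0); apply: le_trans XNp.
  have : (p * N%:R - q * N%:R) * M <= (e * p) * M by rewrite ler_wpM2r //; lra.
  have : p * (e * M) <= p * (N%:R * mu) by rewrite ler_wpM2l // ltW.
  by lra.
have rN : (N - d = r)%N by rewrite /N addnK.
apply: (mulfI (lt0r_neq0 inj0)).
transitivity (\sum_(g in inj) wordsum (fun w => a (wcomp w g)) y).
  rewrite mulr_natl -sumr_const; apply: eq_bigr => g.
  by rewrite inE => /injectiveP gI; rewrite wordsum_injection // rN.
rewrite /wordsum exchange_big mulr_sumr; apply: eq_bigr => w _.
by rewrite mulrA mulrA mulfV ?gt_eqF // mul1r mulr_suml.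
Qed.

End WordForms.

(** * Convex hulls of sets stable under nonnegative scaling, and linear maps *)

Section ConicHull.
Variables (R : realType) (V : lmodType R).
Implicit Types S C : set V.

Lemma convexP C : @convex_set R V C <->
  forall (x y : V) (k : R), 0 <= k -> k <= 1 -> C x -> C y ->
    C (k *: x + (1 - k) *: y).
Proof.
split=> [cC x y k k0 k1 Cx Cy|cC x y k Cx Cy].
  have := cC x y (Itv01 k0 k1); rewrite !inE; exact.
by rewrite inE; apply: cC; [rewrite ge0|rewrite le1|rewrite -inE|rewrite -inE].
Qed.

Lemma convex_hull_convex S : @convex_set R V (convex_hull S).
Proof.
apply/convexP => x y k k0 k1 Sx Sy C [cC SC].
by move/convexP: (cC); apply=> //; [exact: Sx|exact: Sy].
Qed.

Lemma sub_convex_hull S : S `<=` convex_hull S.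
Proof. exact: sub_smallest. Qed.

Lemma convex_hull_sub S C : @convex_set R V C -> S `<=` C -> convex_hull S `<=` C.
Proof. exact: smallest_sub. Qed.

Variable S : set V.
Hypothesis S0 : S 0.
Hypothesis SZ : forall (c : R) x, 0 <= c -> S x -> S (c *: x).

Lemma convex_hullZ (c : R) x : 0 <= c -> convex_hull S x -> convex_hull S (c *: x).
Proof.
move=> c0; move: x; apply: (convex_hull_sub (C := [set x | convex_hull S (c *: x)])).
  apply/convexP => x y k k0 k1 Sx Sy /=.
  rewrite scalerDr !(scalerA c) !(mulrC c) -!(scalerA _ c).
  by have /convexP := @convex_hull_convex S; apply.
by move=> x Sx; apply: sub_convex_hull; apply: SZ.
Qed.

(** The sum is the midpoint of 2x and 2y, which stay in the hull by scaling. *)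
Lemma convex_hullD x y :
  convex_hull S x -> convex_hull S y -> convex_hull S (x + y).
Proof.
move=> Sx Sy; have /convexP cS := @convex_hull_convex S.
have -> : x + y = 2^-1 *: (2 *: x) + (1 - 2^-1) *: (2 *: y).
  rewrite !scalerA (_ : 2^-1 * 2 = 1 :> R); last by field.
  by rewrite (_ : (1 - 2^-1) * 2 = 1 :> R) ?scale1r; last by field.
by apply: cS; rewrite ?invf_le1 ?ler1n //; apply: convex_hullZ.
Qed.

Lemma convex_hull_sum (I : Type) (s : seq I) (P : pred I) (F : I -> V) :
  (forall i, P i -> convex_hull S (F i)) ->
  convex_hull S (\sum_(i <- s | P i) F i).
Proof.
move=> SF; elim/big_rec: _ => [|i x Pi Sx]; first exact: sub_convex_hull.
by apply: convex_hullD => //; exact: SF.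
Qed.

End ConicHull.

Section LinearConvex.
Variables (R : realType) (U V : lmodType R) (h : U -> V).
Hypothesis hl : linear h.

Lemma convex_comb_linear (x y : U) (k : R) :
  h (k *: x + (1 - k) *: y) = k *: h x + (1 - k) *: h y.
Proof.
have h0 : h 0 = 0.
  by have := hl 1 0 0; rewrite !scale1r addr0 -[LHS]addr0 => /addrI.
by rewrite hl; congr (_ + _); have := hl (1 - k) y 0; rewrite !addr0 h0 addr0.
Qed.

Lemma convex_preimage (C : set V) :
  @convex_set R V C -> @convex_set R U (h @^-1` C).
Proof.
move=> /convexP cC; apply/convexP => x y k k0 k1 Cx Cy.
by rewrite /preimage /= convex_comb_linear; exact: cC.
Qed.

Lemma convex_image (C : set U) :
  @convex_set R U C -> @convex_set R V (h @` C).
Proof.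
move=> /convexP cC; apply/convexP => _ _ k k0 k1 [x Cx <-] [y Cy <-].
by exists (k *: x + (1 - k) *: y); [exact: cC|rewrite convex_comb_linear].
Qed.

End LinearConvex.

(** * Calculus of homogeneous forms *)

Lemma wordsumM (R : realType) (I : finType) d e (a : {ffun 'I_d -> I} -> R)
    (b : {ffun 'I_e -> I} -> R) (y : I -> R) :
  wordsum a y * wordsum b y =
  wordsum (fun f : {ffun 'I_(d + e) -> I} => a [ffun t => f (lshift e t)] *
    b [ffun t => f (rshift d t)]) y.
Proof.
pose l (f : {ffun 'I_(d + e) -> I}) : {ffun 'I_d -> I} :=
  [ffun t => f (lshift e t)].
pose r (f : {ffun 'I_(d + e) -> I}) : {ffun 'I_e -> I} :=
  [ffun t => f (rshift d t)].
pose j (p : {ffun 'I_d -> I} * {ffun 'I_e -> I}) : {ffun 'I_(d + e) -> I} :=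
  [ffun t : 'I_(d + e) =>
    match fintype.split t with inl t => p.1 t | inr t => p.2 t end].
have jl p : l (j p) = p.1 by apply/ffunP => t; rewrite !ffunE (unsplitK (inl t)).
have jr p : r (j p) = p.2 by apply/ffunP => t; rewrite !ffunE (unsplitK (inr t)).
rewrite /wordsum mulr_suml [RHS](reindex j) /=; last first.
  exists (fun f => (l f, r f)) => [[f g] _|f _]; first by rewrite jl jr.
  apply/ffunP => t; rewrite -(splitK t) ffunE unsplitK.
  by case: (fintype.split t) => s /=; rewrite ffunE.
rewrite [RHS](eq_bigr (fun p : {ffun 'I_d -> I} * {ffun 'I_e -> I} =>
  (a p.1 * \prod_t y (p.1 t)) * (b p.2 * \prod_t y (p.2 t)))).
  rewrite -(pair_bigA _ (fun f g => (a f * \prod_t y (f t)) *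
    (b g * \prod_t y (g t)))) /=.
  by apply: eq_bigr => f _; rewrite mulr_sumr.
move=> p _; rewrite -/(l (j p)) -/(r (j p)) jl jr.
rewrite big_split_ord /= mulrACA; congr (_ * _ * (_ * _)).
  by apply: eq_bigr => t _; rewrite ffunE (unsplitK (inl t)).
by apply: eq_bigr => t _; rewrite ffunE (unsplitK (inr t)).
Qed.

Section Forms.
Variables (R : realType) (I : finType) (T : Type) (c : T -> I -> R).

(** Only the existence of coefficients is asked, since a form has many families of them; the degree
    is the length of the words. *)
Definition wform d (F : T -> R) :=
  exists a : {ffun 'I_d -> I} -> R, forall x, F x = wordsum a (c x).

Lemma eq_wform d (F G : T -> R) : F =1 G -> wform d F -> wform d G.
Proof. by move=> FG [a aF]; exists a => x; rewrite -FG. Qed.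

Lemma wform_degree d e (F : T -> R) : d = e -> wform d F -> wform e F.
Proof. by move=> ->. Qed.

Lemma wform0 d : wform d (fun=> 0).
Proof.
by exists (fun=> 0) => x; rewrite /wordsum big1 // => f _; rewrite mul0r.
Qed.

Lemma wformD d (F G : T -> R) :
  wform d F -> wform d G -> wform d (fun x => F x + G x).
Proof.
move=> [a aF] [b bG]; exists (fun f => a f + b f) => x.
by rewrite aF bG -big_split; apply: eq_bigr => f _; rewrite mulrDl.
Qed.

Lemma wformZ d (k : R) (F : T -> R) : wform d F -> wform d (fun x => k * F x).
Proof.
move=> [a aF]; exists (fun f => k * a f) => x.
by rewrite aF mulr_sumr; apply: eq_bigr => f _; rewrite mulrA.
Qed.

Lemma wformB d (F G : T -> R) :
  wform d F -> wform d G -> wform d (fun x => F x - G x).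
Proof.
by move=> hF hG; apply: eq_wform (wformD hF (wformZ (-1) hG)) => x; rewrite mulN1r.
Qed.

Lemma wform_sum d (J : Type) (s : seq J) (P : pred J) (F : J -> T -> R) :
  (forall j, P j -> wform d (F j)) -> wform d (fun x => \sum_(j <- s | P j) F j x).
Proof.
move=> hF; elim: s => [|j s IH].
  by apply: eq_wform (wform0 d) => x; rewrite big_nil.
case Pj: (P j); last by apply: eq_wform IH => x; rewrite big_cons Pj.
by apply: eq_wform (wformD (hF j Pj) IH) => x; rewrite big_cons Pj.
Qed.

Lemma wform_cst (k : R) : wform 0 (fun=> k).
Proof.
exists (fun=> k) => x; rewrite /wordsum (big_pred1 (ffun0 (card_ord 0))).
  by rewrite big_ord0 mulr1.
by move=> f; symmetry; apply/eqP/ffunP => -[].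
Qed.

Lemma wform_var i : wform 1 (fun x => c x i).
Proof.
exists (fun f => (f ord0 == i)%:R) => x.
rewrite /wordsum (bigD1 [ffun=> i]) //= ffunE eqxx mul1r big_ord1 ffunE.
rewrite big1 ?addr0 // => f fi; case: eqP => [f0i|]; last by rewrite mul0r.
by case/negP: fi; apply/eqP/ffunP => t; rewrite ffunE (ord1 t).
Qed.

Lemma wformM d e (F G : T -> R) :
  wform d F -> wform e G -> wform (d + e) (fun x => F x * G x).
Proof.
move=> [a aF] [b bG]; eexists => x; rewrite aF bG; exact: wordsumM.
Qed.

Lemma wform_prod (J : Type) (s : seq J) (e : J -> nat) (F : J -> T -> R) :
  (forall j, wform (e j) (F j)) ->
  wform (\sum_(j <- s) e j) (fun x => \prod_(j <- s) F j x).
Proof.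
move=> hF; elim: s => [|j s IH].
  by rewrite big_nil; apply: eq_wform (wform_cst 1) => x; rewrite big_nil.
by rewrite big_cons; apply: eq_wform (wformM (hF j) IH) => x; rewrite big_cons.
Qed.

Lemma wform_ord_prod k (F : 'I_k -> T -> R) :
  (forall j, wform 1 (F j)) -> wform k (fun x => \prod_j F j x).
Proof.
move=> hF; apply: wform_degree (wform_prod (index_enum 'I_k) (e := fun=> 1%N) hF).
by rewrite sum1_card card_ord.
Qed.

Lemma wformX d n (F : T -> R) : wform d F -> wform (n * d) (fun x => F x ^+ n).
Proof.
move=> hF; elim: n => [|n IH]; first exact: wform_cst.
by apply: eq_wform (wformM hF IH) => x; rewrite exprS.
Qed.

End Forms.

(** * Continuity, and a penalty argument on compact sets *)

Section Continuity.
Variables (R : realType) (T : topologicalType).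

Lemma continuous_mulr (F G : T -> R) :
  continuous F -> continuous G -> continuous (fun x => F x * G x).
Proof. by move=> cF cG x; apply: continuousM; [exact: cF|exact: cG]. Qed.

Lemma continuous_sumr (J : Type) (s : seq J) (P : pred J) (F : J -> T -> R) :
  (forall j, P j -> continuous (F j)) ->
  continuous (fun x => \sum_(j <- s | P j) F j x).
Proof.
move=> cF; elim: s => [|j s IH] x.
  by under eq_fun do rewrite big_nil; exact: cst_continuous.
under eq_fun do rewrite big_cons; case Pj: (P j); last exact: IH.
by apply: (@continuousD _ _ _ (F j)); [exact: cF|exact: IH].
Qed.

Lemma continuous_prodr (J : Type) (s : seq J) (P : pred J) (F : J -> T -> R) :
  (forall j, P j -> continuous (F j)) ->
  continuous (fun x => \prod_(j <- s | P j) F j x).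
Proof.
move=> cF; elim: s => [|j s IH] x.
  by under eq_fun do rewrite big_nil; exact: cst_continuous.
under eq_fun do rewrite big_cons; case Pj: (P j); last exact: IH.
by apply: (@continuousM _ _ (F j)); [exact: cF|exact: IH].
Qed.

Lemma wform_continuous (I : finType) (c : T -> I -> R) d (F : T -> R) :
  (forall i, continuous (fun x => c x i)) -> wform c d F -> continuous F.
Proof.
move=> cc [a aF]; rewrite (_ : F = fun x => wordsum a (c x)); last exact: funext.
apply: continuous_sumr => f _ x; apply: (@continuousM _ _ (fun=> a f)).
  exact: cst_continuous.
by apply: continuous_prodr.
Qed.

(** Only the part of K where F <= 0 needs help. It is compact and G is positive on it, so G has a
    positive minimum there and a large C >= 0 lifts F; elsewhere C G >= 0 does no harm. Then mu is
    the minimum over K. *)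
Lemma compact_penalty (K : set T) (F G : T -> R) :
  compact K -> continuous F -> continuous G ->
  (forall x, K x -> 0 <= G x) -> (forall x, K x -> G x = 0 -> 0 < F x) ->
  exists C mu : R, 0 < mu /\ forall x, K x -> mu <= F x + C * G x.
Proof.
move=> Kc Fc Gc G0 GF.
have [K0|/set0P[x0 Kx0]] := eqVneq K set0; first by exists 0, 1; rewrite K0.
pose K' := K `&` F @^-1` [set z | z <= 0].
have K'c : compact K'.
  apply: compact_closedI => //.
  apply: (@preimage_closed _ _ F [set z | z <= 0]) => [x _|]; first exact: Fc.
  exact: closed_le.
have [C hC] : exists C : R, forall x, K x -> 0 < F x + C * G x.
  have [K'0|/set0P K'N0] := eqVneq K' set0.
    exists 0 => x Kx; rewrite mul0r addr0 ltNge; apply/negP => Fx.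
    by have : K' x by []; rewrite K'0.
  have [x1] := compact_EVT_min K'N0 K'c (continuous_subspaceT Gc).
  have [x2] := compact_EVT_min K'N0 K'c (continuous_subspaceT Fc).
  rewrite !inE => K'x2 Fx2 K'x1 Gx1.
  have Gx1_gt0 : 0 < G x1.
    rewrite lt_neqAle G0 ?andbT; last by case: K'x1.
    apply/eqP => /esym/GF => /(_ K'x1.1); apply/negP; rewrite -leNgt.
    by case: K'x1.
  (* On K' one has F >= F x2 and G >= G x1, so this constant, nonnegative as F x2 <= 0, yields F + C
     G >= 1 there. *)
  exists ((1 - F x2) / G x1) => x Kx; have [Fx|Fx] := ltP 0 (F x).
    rewrite ltr_wpDr // mulr_ge0 ?G0 // divr_ge0 ?G0 ?subr_ge0 //; last by case: K'x1.
    by apply: (@le_trans _ _ 0) => //; case: K'x2.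
  have K'x : x \in K' by rewrite inE.
  have : (1 - F x2) / G x1 * G x1 <= (1 - F x2) / G x1 * G x.
    rewrite ler_wpM2l ?Gx1 // divr_ge0 ?ltW // subr_gt0.
    by apply: (@le_lt_trans _ _ 0) => //; case: K'x2.
  rewrite divfK ?gt_eqF //; have := Fx2 _ K'x; lra.
exists C.
have FGc : continuous (fun x => F x + C * G x).
  move=> x; apply: (@continuousD _ _ _ F); first exact: Fc.
  by apply: (@continuousM _ _ (fun=> C)); [exact: cst_continuous|exact: Gc].
have [|x1] := compact_EVT_min _ Kc (continuous_subspaceT FGc); first by exists x0.
rewrite inE => Kx1 x1min; exists (F x1 + C * G x1); split; first exact: hC.
by move=> x Kx; apply: x1min; rewrite inE.
Qed.

End Continuity.

(** * Homogeneous polynomials and sums of squares *)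

Section HomogeneousPolynomials.
Variables (R : realType) (n : nat).
Implicit Types theta : 'rV[R]_n -> R.

Definition rowcoord (x : 'rV[R]_n) (i : 'I_n) : R := x 0 i.

Lemma hpolyP d theta : hpoly d theta <-> wform rowcoord d theta.
Proof.
split=> [[p [/dhomogP hp thp]]|[a ath]].
  have : wform (@rowcoord) d (fun x => \sum_(m <- msupp p | m \in msupp p)
      mcoeff m p * \prod_i x 0 i ^+ m i).
    apply: wform_sum => m /hp mE; apply: wformZ.
    rewrite (_ : d = \sum_i m i)%N; last by rewrite -mE; exact: mdegE.
    apply: (wform_prod _ (e := fun i => m i)
      (F := fun i (x : 'rV[R]_n) => x 0 i ^+ m i)) => i.
    by apply: wform_degree (wformX (m i) (wform_var _ i)); rewrite muln1.
  by apply: eq_wform => x; rewrite thp mevalE [RHS]big_seq.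
exists (\sum_f a f *: \prod_t mpolyX R (mnm1 (f t))); split.
  apply: rpred_sum => f _; apply: rpredZ.
  have : \prod_(t < d) mpolyX R (mnm1 (f t)) \is ishomog1 (\sum_(t < d) 1) mdeg.
    elim/big_rec2: _ => [|t e q _ hq]; first exact: dhomog1.
    by apply: dhomogM hq; rewrite dhomogX; apply/eqP; exact: mdeg1.
  by rewrite sum1_card card_ord.
move=> x; rewrite ath /wordsum rmorph_sum; apply: eq_bigr => f _ /=.
rewrite mevalZ rmorph_prod; congr (_ * _).
by apply: eq_bigr => t _; rewrite /= mevalXU.
Qed.

Lemma sq_hpoly0 k : [set (fun x => theta x ^+ 2) | theta in @hpoly R n k] 0.
Proof.
exists (fun=> 0); first by apply/hpolyP; exact: wform0.
by apply/funext => x; rewrite expr0n.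
Qed.

Lemma sq_hpolyZ k (c : R) (F : 'rV[R]_n -> R) : 0 <= c ->
  [set (fun x => theta x ^+ 2) | theta in @hpoly R n k] F ->
  [set (fun x => theta x ^+ 2) | theta in @hpoly R n k] (c *: F).
Proof.
move=> c0 [theta /hpolyP th <-]; exists (fun x => Num.sqrt c * theta x).
  by apply/hpolyP; exact: wformZ.
by apply/funext => x; rewrite exprMn sqr_sqrtr.
Qed.

Lemma eq_sospoly k (F G : 'rV[R]_n -> R) : F =1 G -> sospoly k F -> sospoly k G.
Proof. by move=> /funext ->. Qed.

Lemma sospolyZ k (c : R) (F : 'rV[R]_n -> R) :
  0 <= c -> sospoly k F -> sospoly k (fun x => c * F x).
Proof. exact: (convex_hullZ (@sq_hpolyZ k)). Qed.

Lemma sospoly_sum k (J : Type) (s : seq J) (F : J -> 'rV[R]_n -> R) :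
  (forall j, sospoly k (F j)) -> sospoly k (fun x => \sum_(j <- s) F j x).
Proof.
move=> hF; apply: (@eq_sospoly _ (\sum_(j <- s) F j)).
  by move=> x; rewrite fct_sumE.
by apply: convex_hull_sum => [||j _]; [exact: sq_hpoly0|exact: sq_hpolyZ|exact: hF].
Qed.

Lemma sospoly_sqr k theta :
  wform rowcoord k theta -> sospoly k (fun x => theta x ^+ 2).
Proof. by move=> /hpolyP th; apply: sub_convex_hull; exists theta. Qed.

Lemma sospoly_ge0 k (F : 'rV[R]_n -> R) x : sospoly k F -> 0 <= F x.
Proof.
suff /(_ F) : @sospoly R n k `<=` [set F | 0 <= F x] by apply.
apply: convex_hull_sub.
  apply/convexP => {}F G t t0 t1 Fx Gx /=.
  by rewrite addr_ge0 // mulr_ge0 // subr_ge0.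
by move=> _ [theta _ <-] /=; exact: sqr_ge0.
Qed.

(** On a generator, |x|^2 theta^2 is the sum of the squares of the x_i theta; multiplication by
    |x|^2 is linear, so this passes to the hull. It is the step from level r to level r + 1 of the
    hierarchy. *)
Lemma sospolyM_sqnorm k (F : 'rV[R]_n -> R) :
  sospoly k F -> sospoly k.+1 (fun x => (\sum_i x 0 i ^+ 2) * F x).
Proof.
pose h (F : 'rV[R]_n -> R) : 'rV[R]_n -> R :=
  fun x => (\sum_i x 0 i ^+ 2) * F x.
have hl : linear h.
  by move=> c G G'; apply/funext => x; rewrite /h /= !fctE mulrDr mulrCA.
suff /(_ F) : @sospoly R n k `<=` h @^-1` @sospoly R n k.+1 by apply.
apply: convex_hull_sub.
  by apply: convex_preimage => //; exact: convex_hull_convex.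
move=> _ [theta /hpolyP th <-].
apply: (@eq_sospoly _ (fun x => \sum_i (x 0 i * theta x) ^+ 2)).
  by move=> x; rewrite /h mulr_suml; apply: eq_bigr => i _; rewrite exprMn.
apply: sospoly_sum => i; apply: sospoly_sqr.
by apply: (wformM (wform_var _ i)).
Qed.

End HomogeneousPolynomials.

(** * Reznick's theorem on uniform denominators *)

Lemma simplex_compact (R : realType) N :
  compact [set y : 'rV[R]_N | (forall k, 0 <= y 0 k) /\ \sum_k y 0 k = 1].
Proof.
apply: (@subclosed_compact _ _ [set y : 'rV[R]_N | forall k, y ord0 k \in `[0, 1]]).
- have -> : [set y : 'rV[R]_N | (forall k, 0 <= y 0 k) /\ \sum_k y 0 k = 1] =
    \bigcap_k [set y : 'rV[R]_N | 0 <= y 0 k] `&` [set y | \sum_k y 0 k = 1].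
    by apply/seteqP; split=> y [y0 y1]; split=> // k; [move=> _|]; exact: y0.
  apply: closedI.
    apply: closed_bigI => k _.
    apply: (@preimage_closed _ _ (fun y : 'rV[R]_N => y 0 k) [set z | 0 <= z]).
      by move=> y _; exact: coord_continuous.
    exact: closed_ge.
  apply: (@preimage_closed _ _ (fun y : 'rV[R]_N => \sum_k y 0 k) [set z | z = 1]).
    by move=> y _; apply: continuous_sumr => k _; exact: coord_continuous.
  exact: closed_eq.
- apply: (@rV_compact _ _ (fun=> `[0 : R, 1]%classic)) => k.
  exact: segment_compact.
move=> y [y0 y1] k /=; rewrite in_itv /= y0 /= -y1 (bigD1 k) //= lerDl.
exact: sumr_ge0.
Qed.

(* A quadratic form in x is a linear form in the squares
   y_(i,j,s) = (x_i + (-1)^s x_j)^2.  The image of x |-> y in the simplex is cut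
   out by equations making the matrix x_i x_j, recovered from y by polarization,
   of rank one with the right trace.  Adding a multiple of the squares of these
   equations makes p, read as a form in y, positive on the whole simplex, and
   Polya's theorem then gives nonnegative coefficients. *)
Lemma reznick (R : realType) n m (p : 'rV[R]_n -> R) :
  wform (@rowcoord R n) (m + m) p -> (forall x : 'rV[R]_n, x != 0 -> 0 < p x) ->
  exists r, sospoly (r + m) (fun x => (\sum_i x 0 i ^+ 2) ^+ r * p x).
Proof.
move=> [a aP] p_gt0.
pose I := ('I_n * 'I_n * bool)%type; pose N := #|{: I}|.
pose l (k : 'I_N) (x : 'rV[R]_n) : R := let: (i, j, s) := enum_val k in
  x 0 i + (-1) ^+ s * x 0 j.
pose yof (x : 'rV[R]_n) : 'rV[R]_N := \row_k l k x ^+ 2.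
pose X (i j : 'I_n) (y : 'rV[R]_N) : R := 4^-1 *
  (y 0 (enum_rank (i, j, false)) - y 0 (enum_rank (i, j, true))).
pose S (y : 'rV[R]_N) : R := \sum_k y 0 k.
(* The sum over all i, j of (x_i + x_j)^2 + (x_i - x_j)^2 is 4 n |x|^2. *)
pose c : R := 4 * n%:R.
pose sq (x : 'rV[R]_n) : R := \sum_i x 0 i ^+ 2.
have Xy x i j : X i j (yof x) = x 0 i * x 0 j.
  by rewrite /X !mxE /l !enum_rankK expr0 expr1; field.
have Sy x : S (yof x) = c * sq x.
  rewrite /S (reindex enum_rank) /=; last first.
    by apply: onW_bij; exact: enum_rank_bij.
  rewrite (eq_bigr (fun u : I =>
      (x 0 u.1.1 + (-1) ^+ u.2 * x 0 u.1.2) ^+ 2)); last first.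
    by move=> [[i j] s] _; rewrite mxE /l enum_rankK.
  rewrite -(pair_bigA _ (fun (u : 'I_n * 'I_n) (s : bool) =>
    (x 0 u.1 + (-1) ^+ s * x 0 u.2) ^+ 2)) /=.
  under eq_bigr => u _ do rewrite big_bool.
  rewrite -(pair_bigA _ (fun i j => (x 0 i + (-1) ^+ true * x 0 j) ^+ 2 +
    (x 0 i + (-1) ^+ false * x 0 j) ^+ 2)) /=.
  rewrite (eq_bigr (fun i => n%:R * (2 * x 0 i ^+ 2) + 2 * sq x)) => [|i _].
    rewrite big_split /= sumr_const card_ord -mulr_sumr -mulr_sumr -/(sq x).
    by rewrite -[X in _ + X]mulr_natl /c; ring.
  rewrite (eq_bigr (fun j => 2 * x 0 i ^+ 2 + 2 * x 0 j ^+ 2)) => [|j _].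
    by rewrite big_split /= sumr_const card_ord -mulr_sumr -[X in X + _]mulr_natl.
  by rewrite expr1 expr0; ring.
(* Each word of length 2m is cut into halves whose t-th letters are paired, so that p, of degree 2m
   in x, becomes a form of degree m in y. *)
pose P (y : 'rV[R]_N) : R := \sum_(f : {ffun 'I_(m + m) -> 'I_n}) a f *
  \prod_(t < m) X (f (lshift m t)) (f (rshift m t)) y.
have PX (x : 'rV[R]_n) y : (forall i j, X i j y = x 0 i * x 0 j) -> P y = p x.
  move=> yX; rewrite aP; apply: eq_bigr => f _; rewrite big_split_ord /= -big_split.
  by congr (_ * _); apply: eq_bigr => t _; exact: yX.
pose T (y : 'rV[R]_N) : R := S y - c * \sum_i X i i y.
pose Q i k j (y : 'rV[R]_N) : R := X i i y * X k j y - X i k y * X i j y.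
(* The factor S^2 gives both penalties degree 4, and S^4 in [F] lets F + C S^m G have the single
   degree 4 + m. On the simplex S = 1, so these factors change nothing there. *)
pose G (y : 'rV[R]_N) : R :=
  S y ^+ 2 * T y ^+ 2 + \sum_i \sum_k \sum_j Q i k j y ^+ 2.
pose F (y : 'rV[R]_N) : R := S y ^+ 4 * P y.
have wX i j : wform (@rowcoord R N) 1 (X i j).
  by apply: wformZ; apply: wformB; exact: wform_var.
have wS : wform (@rowcoord R N) 1 S by apply: wform_sum => k _; exact: wform_var.
have wT : wform (@rowcoord R N) 1 T.
  by apply: wformB => //; apply: wformZ; exact: wform_sum.
have wP : wform (@rowcoord R N) m P.
  by apply: wform_sum => f _; apply: wformZ; exact: wform_ord_prod.
have wG : wform (@rowcoord R N) 4 G.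
  apply: wformD; first by apply: (@wformM _ _ _ _ 2 2); apply: (@wformX _ _ _ _ 1 2).
  apply: wform_sum => i _; apply: wform_sum => k _; apply: wform_sum => j _.
  by apply: (@wformX _ _ _ _ 2 2); apply: wformB; apply: (@wformM _ _ _ _ 1 1).
have wF : wform (@rowcoord R N) (4 + m) F.
  by apply: wformM => //; exact: (@wformX _ _ _ _ 1 4).
have Q2_ge0 y : 0 <= \sum_i \sum_k \sum_j Q i k j y ^+ 2.
  apply: sumr_ge0 => i _; apply: sumr_ge0 => k _; apply: sumr_ge0 => j _.
  exact: sqr_ge0.
have cc k : continuous (fun y : 'rV[R]_N => rowcoord y k).
  exact: coord_continuous.
have [C [mu [mu0 muFG]]] : exists C mu : R, 0 < mu /\ forall y : 'rV[R]_N,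
    ((forall k, 0 <= y 0 k) /\ \sum_k y 0 k = 1) -> mu <= F y + C * G y.
  apply: (compact_penalty (@simplex_compact R N)).
  - exact: wform_continuous wF.
  - exact: wform_continuous wG.
  - move=> y _; apply: addr_ge0; first by rewrite mulr_ge0 ?sqr_ge0.
    exact: Q2_ge0.
  move=> y [y0 y1]; have S1 : S y = 1 by [].
  rewrite /F /G S1 !expr1n !mul1r => /eqP.
  rewrite paddr_eq0 ?sqr_ge0 //.
  rewrite sqrf_eq0 => /andP[/eqP T0 /eqP Q0].
  have QE i k j : X i i y * X k j y = X i k y * X i j y.
    move: Q0 => /psumr_eq0P Q0; apply/eqP; rewrite -subr_eq0 -sqrf_eq0; apply/eqP.
    have Qj_ge0 i' k' : 0 <= \sum_j Q i' k' j y ^+ 2.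
      by apply: sumr_ge0 => j' _; exact: sqr_ge0.
    have /psumr_eq0P Qi := Q0 (fun i _ => sumr_ge0 _ (fun k _ => Qj_ge0 i k)) i isT.
    have /psumr_eq0P Qk := Qi (fun k _ => Qj_ge0 i k) k isT.
    exact: (Qk (fun j _ => sqr_ge0 (Q i k j y)) j isT).
  (* Without a positive diagonal entry, the trace equation T = 0 would force S <= 0, while S = 1. *)
  have [i Xi] : exists i, 0 < X i i y.
    apply: contrapT => Xle; have : \sum_i X i i y <= 0.
      by apply: sumr_le0 => i _; rewrite leNgt; apply/negP => Xi; apply: Xle; exists i.
    have : 0 <= c by rewrite mulr_ge0.
    by move: T0; rewrite /T S1; nra.
  (* The i-th row of the rank-one matrix X, divided by the square root of its diagonal entry, is a
     vector x with X k j = x_k x_j. *)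
  pose x := \row_k (X i k y / Num.sqrt (X i i y)).
  have sX : Num.sqrt (X i i y) ^+ 2 = X i i y by rewrite sqr_sqrtr ?ltW.
  have sX0 : Num.sqrt (X i i y) != 0 by rewrite gt_eqF ?sqrtr_gt0.
  rewrite (PX x) => [|k j].
    apply: p_gt0; apply/eqP => /rowP/(_ i); rewrite !mxE => /eqP.
    by rewrite mulf_eq0 invr_eq0 (negPf sX0) gt_eqF.
  rewrite !mxE mulrACA -QE -invfM -expr2 sX [X i i y * _]mulrC mulfK //.
  by rewrite gt_eqF.
have [b bE] : wform (@rowcoord R N) (4 + m) (fun y => F y + C * (S y ^+ m * G y)).
  apply: wformD => //; apply: wformZ.
  apply: wform_degree (wformM (wformX m wS) wG).
  by rewrite muln1 addnC.
have bmu (y : 'I_N -> R) : (forall k, 0 <= y k) -> \sum_k y k = 1 ->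
    mu <= wordsum b y.
  move=> y0 y1; have -> : y = rowcoord (\row_k y k).
    by apply/funext => k; rewrite /rowcoord mxE.
  have S1 : S (\row_k y k) = 1.
    by rewrite -[RHS]y1; apply: eq_bigr => k _; rewrite mxE.
  rewrite -bE S1 expr1n mul1r; apply: muFG; split=> // k.
  by rewrite mxE.
have [r [b' [b'0 b'E]]] := polya mu0 bmu.
(* Polya's exponent r, plus 4 from the factor S^4 in [F]. *)
exists (r + 4)%N.
have main x : (c * sq x) ^+ (r + 4) * p x =
    \sum_(w : {ffun 'I_(r + (4 + m)) -> 'I_N}) b' w * (\prod_t l (w t) x) ^+ 2.
  have := b'E (rowcoord (yof x)); rewrite -bE.
  have -> : G (yof x) = 0.
    rewrite /G; have -> : T (yof x) = 0.
      rewrite /T Sy (eq_bigr (fun i => x 0 i ^+ 2)) ?subrr // => i _; exact: Xy.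
    rewrite expr0n mulr0 add0r big1 // => i _; rewrite big1 // => k _.
    by rewrite big1 // => j _; rewrite /Q !Xy; ring.
  have -> : \sum_k rowcoord (yof x) k = c * sq x by exact: Sy.
  rewrite !mulr0 addr0 /F Sy mulrA -exprD (PX x) // => ->.
  apply: eq_bigr => w _; congr (_ * _); rewrite -prodrXl.
  by apply: eq_bigr => t _; rewrite /rowcoord mxE.
(* For n = 0 the constant c is 0 and has no inverse, but then |x|^2 is an empty sum. *)
have sqE x : sq x = c^-1 * (c * sq x).
  have [n0|n_gt0] := posnP n; last by rewrite mulKf // mulf_neq0 ?pnatr_eq0 -?lt0n.
  by rewrite /sq big1 ?mulr0 // => i; have := ltn_ord i; rewrite {2}n0.
rewrite -addnA; apply: (@eq_sospoly _ _ _ (fun x => c^-1 ^+ (r + 4) *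
  \sum_(w : {ffun 'I_(r + (4 + m)) -> 'I_N}) b' w * (\prod_t l (w t) x) ^+ 2)).
  by move=> x; rewrite -main mulrA -exprMn -sqE.
apply: sospolyZ; first by rewrite exprn_ge0 // invr_ge0 mulr_ge0.
apply: sospoly_sum => w; apply: sospolyZ => //; apply: sospoly_sqr.
apply: wform_ord_prod => t; rewrite /l; case: (enum_val (w t)) => [[i j] s].
by apply: wformD; [exact: wform_var|apply: wformZ; exact: wform_var].
Qed.

(** * Tensors: linearity, symmetrization and polarization *)

Section TensorAlgebra.
Variables (R : realType) (E : vectType R) (J : euclideanJordan E).
Local Notation n := (\dim {:E}).
Local Notation b := (vbasis {:E}).
Local Notation dot := (jdot J).

Lemma tcoef_linear m (f : tindex E m) : linear_for *%R (fun A : tensor E m => tcoef A f).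
Proof. by move=> c A B; rewrite /tcoef !mxE. Qed.

Lemma tdot_ptensr m (A : tensor E m) (x : 'I_m -> E) :
  tdot J A (ptens x) =
  \sum_(f : tindex E m) tcoef A f * \prod_i dot (tnth b (f i)) (x i).
Proof.
apply: eq_bigr => f _.
have bE z : z = \sum_j coord b j z *: tnth b j.
  rewrite [LHS](coord_vbasis (memvf z)).
  by apply: eq_bigr => j _; rewrite (tnth_nth 0).
rewrite (eq_bigr (fun i => \sum_j coord b j (x i) * dot (tnth b (f i)) (tnth b j))).
  rewrite bigA_distr_bigA mulr_sumr; apply: eq_bigr => g _.
  by rewrite tcoefK big_split mulrA.
move=> i _; rewrite [in LHS](bE (x i)) linear_sumr /=.
by apply: eq_bigr => j _; rewrite linearZr_LR.
Qed.

Lemma tdot_tpow m (A : tensor E m) (x : E) :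
  tdot J A (tpow m x) = wordsum (tcoef A) (fun j => dot (tnth b j) x).
Proof. exact: tdot_ptensr. Qed.

Lemma tdot_linear m (B : tensor E m) : linear_for *%R (fun A => tdot J A B).
Proof.
move=> c A A'; rewrite /tdot mulr_sumr -big_split; apply: eq_bigr => f _ /=.
rewrite mulr_sumr -big_split; apply: eq_bigr => g _ /=.
by rewrite tcoef_linear; ring.
Qed.

Lemma tdotDl m (A A' B : tensor E m) :
  tdot J (A + A') B = tdot J A B + tdot J A' B.
Proof. by have := tdot_linear B 1 A A'; rewrite scale1r mul1r. Qed.

Lemma tdot0l m (B : tensor E m) : tdot J 0 B = 0.
Proof. by apply: (addrI (tdot J 0 B)); rewrite -tdotDl !addr0. Qed.

Lemma tdotZl m (c : R) (A B : tensor E m) : tdot J (c *: A) B = c * tdot J A B.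
Proof. by have := tdot_linear B c A 0; rewrite tdot0l !addr0. Qed.

Lemma tdot_suml m (I : Type) (s : seq I) (P : pred I) (F : I -> tensor E m)
    (B : tensor E m) :
  tdot J (\sum_(i <- s | P i) F i) B = \sum_(i <- s | P i) tdot J (F i) B.
Proof.
apply: (big_morph (fun A => tdot J A B)); last exact: tdot0l.
by move=> A A'; exact: tdotDl.
Qed.

Lemma tpermute_linear m (s : 'S_m) : linear (@tpermute R E m s).
Proof.
by move=> c A B; apply: tensorP => f; rewrite tcoef_linear !tcoefK tcoef_linear.
Qed.

Lemma tpermuteM m (s t : 'S_m) (A : tensor E m) :
  tpermute s (tpermute t A) = tpermute (t * s)%g A.
Proof.
apply: tensorP => f; rewrite !tcoefK; congr tcoef.
by apply/ffunP => i; rewrite !ffunE permM.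
Qed.

Lemma tdot_tpermute m (s : 'S_m) (A : tensor E m) (x : 'I_m -> E) :
  tdot J (tpermute s A) (ptens x) = tdot J A (ptens (x \o s)).
Proof.
rewrite !tdot_ptensr [RHS](reindex (fun f : tindex E m => [ffun i => f (s i)])).
  apply: eq_bigr => f _; rewrite tcoefK; congr (_ * _).
  rewrite (reindex_inj (@perm_inj _ s)) /=.
  by apply: eq_bigr => i _; rewrite ffunE.
exists (fun f : tindex E m => [ffun i => f ((s^-1)%g i)]) => f _;
  by apply/ffunP => i; rewrite !ffunE ?permK ?permKV.
Qed.

Lemma symtensorD m (A B : tensor E m) :
  symtensor A -> symtensor B -> symtensor (A + B).
Proof.
move=> sA sB s; have := tpermute_linear s 1 A B.
by rewrite !scale1r sA sB.
Qed.

Lemma symtensor0 m : @symtensor R E m 0.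
Proof. by move=> s; apply: tensorP => f; rewrite tcoefK /tcoef !mxE. Qed.

Lemma symtensorZ m (c : R) (A : tensor E m) : symtensor A -> symtensor (c *: A).
Proof.
move=> sA s; have := tpermute_linear s c A 0.
by rewrite (symtensor0 s) sA !addr0.
Qed.

Lemma symmetrize_sym m (A : tensor E m) : symtensor (symmetrize A).
Proof.
rewrite /symmetrize; apply: symtensorZ => s.
rewrite (big_morph (tpermute s) (id1 := 0) (op1 := +%R)).
- rewrite [RHS](reindex_inj (mulIg s)) /=.
  by apply: eq_bigr => t _; exact: tpermuteM.
- by move=> B C; have := tpermute_linear s 1 B C; rewrite !scale1r.
- exact: symtensor0.
Qed.

Lemma tdot_symmetrize m (A : tensor E m) x :
  tdot J (symmetrize A) (tpow m x) = tdot J A (tpow m x).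
Proof.
rewrite tdotZl tdot_suml (eq_bigr (fun=> tdot J A (tpow m x))) => [|s _].
  rewrite sumr_const -[X in _ * X]mulr_natl card_Sn mulrA mulVf ?mul1r //.
exact: tdot_tpermute.
Qed.

Lemma tdot_tprod m k (A : tensor E m) (B : tensor E k) x :
  tdot J (tprod A B) (tpow (m + k) x) = tdot J A (tpow m x) * tdot J B (tpow k x).
Proof.
rewrite !tdot_tpow wordsumM; apply: eq_bigr => f _.
by rewrite tcoefK.
Qed.

Lemma tdot_sym_square k (B : tensor E k) x :
  tdot J (symmetrize (tprod B B)) (tpow (k + k) x) = tdot J B (tpow k x) ^+ 2.
Proof. by rewrite tdot_symmetrize tdot_tprod. Qed.

(** This is (-1)^(m - |S|), written as a product so that a sum over all S refolds into a product
    over indices by [bigA_distr]. *)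
Definition psgn m (S : {set 'I_m}) : R := \prod_i (if i \in S then 1 else -1).

(* Expanding the right-hand side over maps g of the factors, the signs cancel
   unless g is onto, hence a permutation. *)
Lemma polarization m (A : tensor E m) (y : 'I_m -> E) : symtensor A ->
  m`!%:R * tdot J A (ptens y) =
  \sum_(S : {set 'I_m}) psgn S * tdot J A (tpow m (\sum_(i in S) y i)).
Proof.
move=> sA.
have expand (S : {set 'I_m}) : tdot J A (tpow m (\sum_(i in S) y i)) =
    \sum_(g : {ffun 'I_m -> 'I_m}) (\prod_t (g t \in S)%:R) * tdot J A (ptens (y \o g)).
  rewrite tdot_ptensr.
  under [RHS]eq_bigr => g _ do rewrite tdot_ptensr mulr_sumr.
  rewrite exchange_big; apply: eq_bigr => f _ /=.
  under eq_bigr => t _.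
    rewrite linear_sumr big_mkcond /=.
    rewrite (eq_bigr (fun i => (i \in S)%:R * dot (tnth b (f t)) (y i))); last first.
      by move=> i _; case: (i \in S); rewrite ?mul1r ?mul0r.
    over.
  rewrite bigA_distr_bigA mulr_sumr; apply: eq_bigr => g _.
  by rewrite big_split mulrCA.
under eq_bigr => S _ do rewrite expand mulr_sumr.
rewrite exchange_big /=.
under eq_bigr => g _ do (under eq_bigr => S _ do rewrite mulrA).
under eq_bigr => g _ do rewrite -mulr_suml.
have signs (g : {ffun 'I_m -> 'I_m}) :
    \sum_(S : {set 'I_m}) psgn S * \prod_t (g t \in S)%:R = (injectiveb g)%:R.
  transitivity (\prod_i (1 + - (i \notin codom g)%:R : R)).
    rewrite bigA_distr; apply: eq_big => [S|S _]; first by rewrite inE.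
    have [/forallP gS|] := boolP [forall t, g t \in S].
      rewrite [X in _ * X]big1 ?mulr1 => [|t _]; last by rewrite gS.
      apply: eq_bigr => i _; case: ifPn => // iS.
      suff -> : i \notin codom g by [].
      by apply: contra iS => /codomP[t ->].
    rewrite negb_forall => /existsP[t gt].
    rewrite [X in _ * X](bigD1 t) //= (negPf gt) mul0r mulr0.
    by rewrite (bigD1 (g t)) //= (negPf gt) codom_f oppr0 mul0r.
  have [gI|gNI] := boolP (injectiveb g).
    rewrite big1 // => i _; rewrite (_ : i \in codom g) ?subr0 //.
    exact: injF_onto (injectiveP _ gI) i.
  have [i ig] : exists i, i \notin codom g.
    apply/existsP; apply: contraR gNI; rewrite negb_exists => /forallP gS.
    have /image_injP gI : #|codom g| == #|'I_m|.
      by apply/eqP/eq_card => i; have := gS i; rewrite negbK => ->.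
    by apply/injectiveP => i j; exact: gI.
  by rewrite (bigD1 i) //= ig subrr mul0r.
under eq_bigr => g _ do rewrite signs.
rewrite (bigID (fun g : {ffun 'I_m -> 'I_m} => injectiveb g)) /=.
rewrite [X in _ + X]big1 ?addr0; last first.
  by move=> g /negPf ->; rewrite mul0r.
rewrite (reindex (fun s : 'S_m => pval s)) /=; last first.
  exists (insubd (1%g : 'S_m)) => [s _|g gI]; first exact: valKd.
  by rewrite insubdK.
rewrite mulr_natl -card_Sn -sumr_const.
apply: eq_big => [s|s _]; first by rewrite (valP s).
rewrite (_ : injectiveb _ = true) ?mul1r; last exact: (valP s).
rewrite -[in LHS](sA s) tdot_tpermute; congr (tdot J A (ptens _)).
by apply/funext => i /=; rewrite -pvalE.
Qed.

End TensorAlgebra.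

(** * The dictionary between symmetric tensors and polynomials *)

Section Orthonormal.
Variables (R : realType) (E : vectType R) (J : euclideanJordan E).
Variable v : (\dim {:E}).-tuple E.
Hypothesis hv : orthonormal_basis J v.
Local Notation n := (\dim {:E}).
Local Notation b := (vbasis {:E}).
Local Notation dot := (jdot J).
Local Notation phi := (passmx.rVof v).
Local Notation phi_inv := (passmx.vecof v).
Local Notation psi := (psi J v).

Let phiK : cancel phi phi_inv.
Proof. by apply: passmx.rVofK; case: hv. Qed.

Lemma phi_invE (X : 'rV[R]_n) : phi_inv X = \sum_i X 0 i *: tnth v i.
Proof. by apply: eq_bigr => i _; rewrite (tnth_nth 0). Qed.

Lemma dot_phi_inv x (X : 'rV[R]_n) :
  dot x (phi_inv X) = \sum_i X 0 i * dot x (tnth v i).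
Proof.
rewrite phi_invE linear_sumr; apply: eq_bigr => i _.
by rewrite linearZr_LR.
Qed.

Lemma dot_basis i (X : 'rV[R]_n) : dot (tnth v i) (phi_inv X) = X 0 i.
Proof.
rewrite dot_phi_inv (bigD1 i) //= hv.2 eqxx mulr1 big1 ?addr0 // => j ji.
by rewrite hv.2 eq_sym (negPf ji) mulr0.
Qed.

Lemma dot_sqnorm (X : 'rV[R]_n) :
  dot (phi_inv X) (phi_inv X) = \sum_i X 0 i ^+ 2.
Proof.
rewrite {1}phi_invE linear_sumlz; apply: eq_bigr => i _.
by rewrite linearZl_LR /= dot_basis expr2.
Qed.

Lemma mulmx_trE (X : 'rV[R]_n) : (X *m X^T) 0 0 = \sum_i X 0 i ^+ 2.
Proof. by rewrite !mxE; apply: eq_bigr => i _; rewrite mxE expr2. Qed.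

(** The Riesz representative of the linear form [coord b j], expanded in the orthonormal [v]; these
    vectors form the dual basis of [b]. *)
Definition dual_vbasis (j : 'I_n) : E := \sum_k coord b j (tnth v k) *: tnth v k.

Lemma dot_dual_vbasis i j : dot (tnth b i) (dual_vbasis j) = (i == j)%:R.
Proof.
have dotC x y : dot x y = dot y x.
  by have := hermC (jdot J) x y; rewrite /= expr0 mul1r.
rewrite /dual_vbasis linear_sumr /=.
transitivity (coord b j (tnth b i)); last first.
  by rewrite coord_vbasis_tnth eq_sym.
rewrite -[tnth b i in RHS]phiK phi_invE linear_sum; apply: eq_bigr => k _ /=.
rewrite linearZr_LR linearZ /= mulrC; congr (_ * _).
by rewrite -[tnth b i in LHS]phiK dotC dot_basis.
Qed.

Lemma tcoef_dual m (A : tensor E m) (f : tindex E m) :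
  tdot J A (ptens (fun i => dual_vbasis (f i))) = tcoef A f.
Proof.
rewrite tdot_ptensr (bigD1 f) //= big1 => [|i _]; last first.
  by rewrite dot_dual_vbasis eqxx.
rewrite mulr1 big1 ?addr0 // => g gf.
have [i gfi] : exists i, g i != f i.
  apply/existsP; apply: contraR gf; rewrite negb_exists => /forallP h.
  by apply/eqP/ffunP => i; have := h i; rewrite negbK => /eqP.
by rewrite (bigD1 i) //= dot_dual_vbasis (negPf gfi) mul0r mulr0.
Qed.

Definition dual_point m (f : tindex E m) (S : {set 'I_m}) : E :=
  \sum_(i in S) dual_vbasis (f i).

(** Polarization at dual basis vectors reads a coordinate off finitely many values of the
    polynomial, at points independent of A. The injectivity of [psi] and the bound on the squares
    both rest on this. *)
Lemma tcoef_polar m (A : tensor E m) (f : tindex E m) : symtensor A ->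
  m`!%:R * tcoef A f =
  \sum_(S : {set 'I_m}) psgn R S * tdot J A (tpow m (dual_point f S)).
Proof. by move=> sA; rewrite -tcoef_dual polarization. Qed.

Lemma norm_tcoef_le m (A : tensor E m) (f : tindex E m) : symtensor A ->
  `|tcoef A f| <= \sum_(S : {set 'I_m}) `|tdot J A (tpow m (dual_point f S))|.
Proof.
move=> sA; have m1 : 1 <= m`!%:R :> R by rewrite ler1n fact_gt0.
apply: (@le_trans _ _ (m`!%:R * `|tcoef A f|)); first by rewrite ler_peMl.
rewrite -{1}(ger0_norm (le_trans ler01 m1)) -normrM tcoef_polar //.
apply: (le_trans (ler_norm_sum _ _ _)); apply: ler_sum => S _.
rewrite normrM (_ : `|psgn R S| = 1) ?mul1r // /psgn normr_prod big1 // => i _.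
by case: ifP => _; rewrite ?normrN normr1.
Qed.

Lemma tdot_tpow_inj m (A B : tensor E m) : symtensor A -> symtensor B ->
  (forall x, tdot J A (tpow m x) = tdot J B (tpow m x)) -> A = B.
Proof.
move=> sA sB AB; apply: tensorP => f.
have m0 : m`!%:R != 0 :> R by rewrite pnatr_eq0 -lt0n fact_gt0.
apply: (mulfI m0); rewrite !tcoef_polar //.
by apply: eq_bigr => S _; rewrite AB.
Qed.

Lemma psi_inj m (A B : tensor E m) : symtensor A -> symtensor B ->
  psi m A = psi m B -> A = B.
Proof.
move=> sA sB AB; apply: tdot_tpow_inj => // x.
by rewrite -(phiK x); exact: (congr1 (fun F => F (phi x)) AB).
Qed.

Lemma psi_linear m : linear (psi m : tensor E m -> 'rV[R]_n -> R).
Proof. by move=> c A B; apply/funext => X; exact: tdot_linear. Qed.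

Lemma wform_psi m (A : tensor E m) : wform (@rowcoord R n) m (psi m A).
Proof.
apply: (@eq_wform _ _ _ _ _ (fun X : 'rV[R]_n =>
  wordsum (tcoef A) (fun j => dot (tnth b j) (phi_inv X)))).
  by move=> X; rewrite /Defs.psi tdot_tpow.
apply: wform_sum => f _; apply: wformZ; apply: wform_ord_prod => i.
apply: (@eq_wform _ _ _ _ _ (fun X : 'rV[R]_n =>
    \sum_k dot (tnth b (f i)) (tnth v k) * X 0 k)).
  by move=> X; rewrite dot_phi_inv; apply: eq_bigr => k _; rewrite mulrC.
by apply: wform_sum => k _; apply: wformZ; exact: wform_var.
Qed.

(** Put the coefficient of a word on the tensor product of the corresponding vectors of [v]: by
    orthonormality, pairing with a power gives the monomial. Symmetrizing does not change values on
    powers. *)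
Lemma psi_surj m (theta : 'rV[R]_n -> R) : wform (@rowcoord R n) m theta ->
  exists2 A, symtensor A & psi m A = theta.
Proof.
move=> [a ath].
exists (symmetrize (\sum_(f : {ffun 'I_m -> 'I_n}) a f *:
    ptens (fun i => tnth v (f i)))); first exact: symmetrize_sym.
apply/funext => X; rewrite /Defs.psi tdot_symmetrize tdot_suml ath.
apply: eq_bigr => f _; rewrite tdotZl tdot_ptens; congr (_ * _).
by apply: eq_bigr => i _; rewrite dot_basis.
Qed.

Lemma SOS_sub_sym k : SOS E k `<=` @symtensor R E (k + k).
Proof.
apply: convex_hull_sub => [|_ [B _ <-]]; last exact: symmetrize_sym.
apply/convexP => A B t _ _ sA sB.
by apply: symtensorD; apply: symtensorZ.
Qed.

Lemma psi_SOS k : psi (k + k)%N @` SOS E k = @sospoly R n k.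
Proof.
have psi_sq B : psi (k + k)%N (symmetrize (tprod B B)) = fun X => psi k B X ^+ 2.
  by apply/funext => X; exact: tdot_sym_square.
apply/seteqP; split=> [_ [A sosA <-]|].
  suff /(_ A) : SOS E k `<=` psi (k + k)%N @^-1` @sospoly R n k by apply.
  apply: convex_hull_sub => [|_ [B _ <-]].
    apply: (convex_preimage (@psi_linear (k + k))); exact: convex_hull_convex.
  rewrite /preimage /= psi_sq; apply: sospoly_sqr; exact: wform_psi.
apply: convex_hull_sub => [|_ [theta /hpolyP/psi_surj[B sB <-] <-]].
  apply: (convex_image (@psi_linear (k + k))); exact: convex_hull_convex.
exists (symmetrize (tprod B B)); last exact: psi_sq.
by apply: sub_convex_hull; exists B.
Qed.

Definition square_form m (A : tensor E m) : 'rV[R]_n -> R :=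
  fun X => psi m A (lozenge J v X X).

Lemma square_formE m (A : tensor E m) (X : 'rV[R]_n) :
  square_form A X = tdot J A (tpow m (jmul J (phi_inv X) (phi_inv X))).
Proof. by rewrite /square_form /Defs.psi /lozenge phiK. Qed.

Lemma wform_square_form m (A : tensor E m) :
  wform (@rowcoord R n) (m + m) (square_form A).
Proof.
pose q (j : 'I_n) (X : 'rV[R]_n) := dot (tnth b j) (jmul J (phi_inv X) (phi_inv X)).
have wq j : wform (@rowcoord R n) 2 (q j).
  apply: (@eq_wform _ _ _ _ _ (fun X : 'rV[R]_n => \sum_k \sum_l
      dot (tnth b j) (jmul J (tnth v k) (tnth v l)) * (X 0 k * X 0 l))).
    move=> X; rewrite /q {1}phi_invE linear_sumlz linear_sumr /=.
    apply: eq_bigr => k _; rewrite linearZl_LR linearZr_LR /= phi_invE.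
    rewrite linear_sumr linear_sumr /= mulr_sumr; apply: eq_bigr => l _.
    by rewrite !linearZr_LR /GRing.scale /=; ring.
  apply: wform_sum => k _; apply: wform_sum => l _; apply: wformZ.
  by apply: (@wformM _ _ _ _ 1 1); exact: wform_var.
apply: (@eq_wform _ _ _ _ _ (fun X : 'rV[R]_n =>
    \sum_(f : tindex E m) tcoef A f * \prod_i q (f i) X)).
  by move=> X; rewrite square_formE tdot_tpow.
apply: wform_sum => f _; apply: wformZ.
apply: wform_degree (wform_prod (index_enum 'I_m) (e := fun=> 2%N)
  (F := fun i => q (f i)) (fun i => wq (f i))).
by rewrite sum_nat_const card_ord muln2 addnn.
Qed.

Definition lift_form m r (A : tensor E m) : 'rV[R]_n -> R :=
  fun X => (\sum_i X 0 i ^+ 2) ^+ r * square_form A X.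

Lemma wform_lift_form m r (A : tensor E m) :
  wform (@rowcoord R n) ((r + m) + (r + m)) (lift_form r A).
Proof.
have wsq : wform (@rowcoord R n) 2 (fun X => \sum_i X 0 i ^+ 2).
  by apply: wform_sum => i _; apply: (@wformX _ _ _ _ 1 2); exact: wform_var.
apply: wform_degree (wformM (wformX r wsq) (wform_square_form A)).
by rewrite muln2 -addnn addnACA.
Qed.

Lemma lift_form_linear m r : linear (@lift_form m r).
Proof.
move=> c A B; apply/funext => X.
by rewrite /lift_form /square_form psi_linear !fctE mulrDr mulrCA.
Qed.

(** The surjectivity of [psi] supplies a tensor satisfying [lift_spec], so [xget] returns one that
    does and never falls back on its default. *)
Lemma lift_tensorP m r (A : tensor E m) :
  symtensor (lift_tensor J r A) /\ psi _ (lift_tensor J r A) = lift_form r A.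
Proof.
have [B sB psiB] := psi_surj (wform_lift_form r A).
have : lift_spec J A (lift_tensor J r A).
  apply: (@xgetPex _ 0 (lift_spec (r := r) J A)); exists B; split=> // x.
  have := congr1 (fun F => F (phi x)) psiB.
  by rewrite /Defs.psi /lift_form square_formE -dot_sqnorm phiK => ->.
move=> [sL LE]; split=> //; apply/funext => X.
by rewrite /Defs.psi -LE dot_sqnorm -square_formE.
Qed.

(** All later facts about [KNN] go through this form or the lift itself. Conversely, a tensor of
    [SOS] with the polynomial of the lift is the lift, as both are symmetric and [psi] is injective
    there. *)
Lemma KNN_sospoly m r (A : tensor E m) :
  KNN J m r A <-> symtensor A /\ @sospoly R n (r + m) (lift_form r A).
Proof.
have [sL psiL] := lift_tensorP r A; rewrite -psiL -psi_SOS.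
split=> [[sA sosA]|[sA [B sosB /psi_inj BE]]]; split=> //.
by rewrite -BE //; exact: SOS_sub_sym.
Qed.

Lemma KNNpoly_psi m r (A : tensor E m) :
  KNNpoly J v m r (psi m A) <-> @sospoly R n (r + m) (lift_form r A).
Proof.
have -> : lift_form r A = fun X =>
    (X *m X^T) 0 0 ^+ r * psi m A (lozenge J v X X).
  by apply/funext => X; rewrite mulmx_trE.
by split=> [[]|] //; split=> //; apply/hpolyP; exact: wform_psi.
Qed.

End Orthonormal.

(** * Closedness of the cone of sums of squares *)

Section Caratheodory.
Variables (R : realType) (D : nat) (S : set 'rV[R]_D).
Hypothesis S0 : S 0.
Hypothesis SZ : forall (c : R) x, 0 <= c -> S x -> S (c *: x).

(** More than D vectors are linearly dependent, and subtracting a suitable multiple of a relation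
    removes one of them while rescaling the others by nonnegative factors. *)
Lemma conic_caratheodory N (s : 'I_N -> 'rV[R]_D) : (forall i, S (s i)) ->
  exists2 t : 'I_D -> 'rV[R]_D, (forall i, S (t i)) & \sum_i s i = \sum_i t i.
Proof.
elim: N s => [|N IH] s sS.
  by exists (fun=> 0) => //; rewrite big_ord0 sumr_const mul0rn.
have [ND|DN] := leqP N.+1 D.
  (* Too few vectors: the family is padded with zeros. *)
  pose F (i : nat) : 'rV[R]_D := oapp s 0 (insub i).
  exists (fun i => F i) => [i|]; first by rewrite /F; case: insubP => /=.
  rewrite (eq_bigr (fun i : 'I_N.+1 => F i)) => [|i _]; last by rewrite /F valK.
  rewrite (big_ord_widen _ F ND) big_mkcond; apply: eq_bigr => i _.
  by case: ifPn => // iN; rewrite /F insubN.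
have [c [i0 ci0] cs0] : exists2 c : 'I_N.+1 -> R, exists i, 0 < c i &
    \sum_i c i *: s i = 0.
  pose M := \matrix_i s i.
  have : kermx M != 0.
    rewrite kermx_eq0 /row_free; apply: contraL DN => /eqP rM.
    by rewrite -leqNgt -{1}rM rank_leq_col.
  case/rowV0Pn => u /sub_kermxP uM u0.
  have uS : \sum_i u 0 i *: s i = 0.
    rewrite -[RHS]uM mulmx_sum_row; apply: eq_bigr => i _.
    by rewrite rowK.
  have /rV0Pn[i ui] := u0; have [ui_gt0|ui_le0] := ltP 0 (u 0 i).
    by exists (fun i => u 0 i) => //; exists i.
  exists (fun i => - u 0 i); first by exists i; rewrite oppr_gt0 lt_neqAle ui.
  by under eq_bigr do rewrite scaleNr; rewrite sumrN uS oppr0.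
(* With the largest coefficient c_k, positive by the choice of the sign of the relation, every 1 -
   c_i / c_k is nonnegative and the k-th is zero. *)
pose k := [arg max_(i > i0) c i]%O.
have ck i : c i <= c k by rewrite /k; case: arg_maxP => // j _; apply.
have ck0 : 0 < c k by apply: lt_le_trans (ck i0).
pose s' i := (1 - c i / c k) *: s i.
have s'S i : S (s' i).
  by apply: SZ => //; rewrite subr_ge0 ler_pdivrMr // mul1r.
have [t tS st] := IH (fun i => s' (lift k i)) (fun i => s'S _).
exists t => //; rewrite -st.
have -> : \sum_i s i = \sum_i s' i.
  under [RHS]eq_bigr do rewrite /s' scalerBl scale1r mulrC -scalerA.
  by rewrite sumrB -scaler_sumr cs0 scaler0 subr0.
by rewrite (bigD1_ord k) //= /s' divff ?gt_eqF // subrr scale0r add0r.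
Qed.

End Caratheodory.

Lemma continuous_rV (R : realType) (T : topologicalType) D (f : T -> 'rV[R]_D) :
  (forall k, continuous (fun x => f x 0 k)) -> continuous f.
Proof.
move=> cf x A [P nP PA]; rewrite /nbhs /=.
have : \forall y \near x, forall k : 'I_D, P 0 k (f y 0 k).
  by apply: filter_forall => k; apply: cf; exact: nP.
apply: filterS => y yP; apply: PA => i k.
by rewrite (ord1 i).
Qed.

Lemma compact_sums (R : realType) (V : normedModType R) (C : set V) d :
  compact C ->
  compact [set \sum_(i < d) t i | t in [set t : 'I_d -> V | forall i, C (t i)]].
Proof.
move=> cC; elim: d => [|d IH].
  rewrite (_ : _ @` _ = [set 0]); first exact: compact_set1.
  apply/seteqP; split=> [_ [t _ <-]|_ ->]; first by rewrite big_ord0.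
  by exists (fun=> 0); [case|rewrite big_ord0].
rewrite (_ : _ @` _ = (fun p : V * V => p.1 + p.2) @` (C `*`
  [set \sum_(i < d) t i | t in [set t : 'I_d -> V | forall i, C (t i)]])).
  apply: continuous_compact; last exact: compact_setX.
  apply: continuous_subspaceT => p; apply: (@continuousD _ _ _ fst snd).
    exact: cvg_fst.
  exact: cvg_snd.
apply/seteqP; split=> [_ [t tC <-]|_ [[x _] [/= Cx [t tC <-]] <-]].
  exists (t ord0, \sum_(i < d) t (lift ord0 i)); last by rewrite big_ord_recl.
  by split=> //=; exists (fun i => t (lift ord0 i)).
exists (fun i => if unlift ord0 i is Some j then t j else x).
  by move=> i; case: unlift.
rewrite big_ord_recl unlift_none; congr (_ + _).
by apply: eq_bigr => i _; rewrite liftK.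
Qed.

Lemma linear_rV_continuous (R : realType) N D (h : 'rV[R]_N -> 'rV[R]_D) :
  linear h -> continuous h.
Proof.
move=> hl; have h0 : h 0 = 0.
  by have := hl 1 0 0; rewrite !scale1r addr0 -[LHS]addr0 => /addrI.
have hE x : h x = \sum_k x 0 k *: h (delta_mx 0 k).
  rewrite {1}(row_sum_delta x); elim/big_rec2: _ => // k y z _ <-.
  exact: hl.
apply: continuous_rV => j.
rewrite (_ : (fun x => h x 0 j) =
  fun x : 'rV[R]_N => \sum_k x 0 k * h (delta_mx 0 k) 0 j).
  apply: continuous_sumr => k _ x.
  apply: (@continuousM _ _ (fun x : 'rV[R]_N => x 0 k)); first exact: coord_continuous.
  exact: cst_continuous.
by apply/funext => x; rewrite hE summxE; apply: eq_bigr => k _; rewrite mxE.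
Qed.

Section SOSClosed.
Variables (R : realType) (E : vectType R) (J : euclideanJordan E).
Variable v : (\dim {:E}).-tuple E.
Hypothesis hv : orthonormal_basis J v.
Variable k : nat.
Local Notation D := #|{: tindex E (k + k)}|.

Definition tsquare (B : tensor E k) : tensor E (k + k) := symmetrize (tprod B B).

Lemma tsquareZ (c : R) (B : tensor E k) :
  0 <= c -> c *: tsquare B = tsquare (Num.sqrt c *: B).
Proof.
move=> c0; apply/rowP => j; rewrite !mxE !summxE mulrCA; congr (_ * _).
rewrite mulr_sumr; apply: eq_bigr => s _.
by rewrite !mxE !tcoefK /tcoef !mxE mulrACA -expr2 sqr_sqrtr.
Qed.

(** The number D of squares is the dimension of the ambient tensor space, the same for every T. A
    convex combination of two such sums has 2D terms, which Caratheodory brings back to D. *)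
Lemma SOS_sums (T : tensor E (k + k)) : SOS E k T <->
  exists2 B : 'I_D -> tensor E k, forall i, symtensor (B i) &
    T = \sum_i tsquare (B i).
Proof.
have S0 : [set tsquare B | B in @symtensor R E k] 0.
  exists 0; first exact: symtensor0.
  by rewrite -(scale0r 0) -[in X in tsquare X]sqrtr0 -tsquareZ ?scale0r.
have SZ (c : R) x : 0 <= c -> [set tsquare B | B in @symtensor R E k] x ->
    [set tsquare B | B in @symtensor R E k] (c *: x).
  move=> c0 [B sB <-]; exists (Num.sqrt c *: B); first exact: symtensorZ.
  by rewrite -tsquareZ.
split; last first.
  move=> [B sB ->]; apply: (convex_hull_sum S0 SZ) => i _.
  by apply: sub_convex_hull; exists (B i).
suff /(_ T) : SOS E k `<=` [set T | exists2 t : 'I_D -> tensor E (k + k),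
    (forall i, [set tsquare B | B in @symtensor R E k] (t i)) & T = \sum_i t i].
  move=> h /h[t tS ->].
  have /choice[B BE] i : exists B, symtensor B /\ tsquare B = t i.
    by have [B sB Bt] := tS i; exists B.
  exists B => [i|]; first by case: (BE i).
  by apply: eq_bigr => i _; case: (BE i).
apply: convex_hull_sub => [|T' ST'].
  apply/convexP => _ _ c c0 c1 [t tS ->] [u uS ->].
  pose w (i : 'I_(D + D)) := match fintype.split i with
    | inl i => c *: t i | inr i => (1 - c) *: u i end.
  have wS i : [set tsquare B | B in @symtensor R E k] (w i).
    by rewrite /w; case: fintype.split => j; apply: SZ; rewrite ?subr_ge0.
  have [w' w'S wE] := conic_caratheodory S0 SZ wS.
  exists w' => //; rewrite -wE big_split_ord !scaler_sumr /=.
  by congr (_ + _); apply: eq_bigr => i _;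
    rewrite /w (unsplitK (inl i), unsplitK (inr i)).
have [t tS tE] := conic_caratheodory S0 SZ (fun _ : 'I_1 => ST').
by exists t => //; rewrite -tE big_ord1.
Qed.

Lemma tsquare_continuous : continuous tsquare.
Proof.
apply: continuous_rV => j.
rewrite (_ : (fun B => tsquare B 0 j) = fun B : tensor E k => \sum_(s : 'S_(k + k))
  ((k + k)`!%:R^-1 *
  (B 0 (enum_rank [ffun i => enum_val j (s (lshift k i))]) *
   B 0 (enum_rank [ffun i => enum_val j (s (rshift k i))])))).
  apply: continuous_sumr => s _.
  apply: (@continuous_mulr _ _ (fun=> (k + k)`!%:R^-1)) => [B|].
    exact: cst_continuous.
  by apply: continuous_mulr => B; exact: coord_continuous.
apply/funext => B; rewrite !mxE summxE mulr_sumr; apply: eq_bigr => s _.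
rewrite !mxE !tcoefK /tcoef; congr (_ * (B 0 (enum_rank _) * B 0 (enum_rank _))).
- by apply/ffunP => i; rewrite !ffunE.
- by apply/ffunP => i; rewrite !ffunE.
Qed.

Lemma symtensor_closed m : closed (@symtensor R E m).
Proof.
have -> : @symtensor R E m = \bigcap_(p : 'S_m * tindex E m)
    [set A | tcoef A [ffun i => p.2 (p.1 i)] - tcoef A p.2 = 0].
  apply/seteqP; split=> A sA.
    by move=> [s f] _ /=; rewrite -[in X in _ - X](sA s) tcoefK subrr.
  move=> s; apply: tensorP => f; apply/eqP; rewrite tcoefK -subr_eq0; apply/eqP.
  exact: (sA (s, f)).
apply: closed_bigI => -[s f] _ /=.
apply: (@preimage_closed _ _ (fun A : tensor E m =>
  tcoef A [ffun i => f (s i)] - tcoef A f) [set z | z = 0]); last exact: closed_eq.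
by move=> A _; apply: (@continuousB _ _ _ (fun A : tensor E m => tcoef A _)
  (fun A : tensor E m => tcoef A _)); exact: coord_continuous.
Qed.

Definition sym_box (M : R) : set (tensor E k) :=
  @symtensor R E k `&` [set B | forall j, B ord0 j \in `[- M, M]].

Lemma sym_box_compact M : compact (sym_box M).
Proof.
rewrite /sym_box setIC; apply: compact_closedI; last exact: symtensor_closed.
by apply: (@rV_compact _ _ (fun=> `[- M, M]%classic)) => j; exact: segment_compact.
Qed.

(** Squares cannot cancel: at each point every single square is at most the value of the sum, which
    the coordinates bound. At the finitely many points [dual_point] this controls the coordinates of
    each B i. *)
Lemma SOS_bounded (c : R) : exists M, forall B : 'I_D -> tensor E k,
  (forall i, symtensor (B i)) ->
  (forall f, `|tcoef (\sum_i tsquare (B i)) f| <= c) -> forall i, sym_box M (B i).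
Proof.
pose w (f : tindex E k) (S : {set 'I_k}) : R :=
  \sum_(g : tindex E (k + k)) c *
    \prod_i `|jdot J (tnth (vbasis {:E}) (g i)) (dual_point v f S)|.
(* The added 1 comes from |t| <= t^2 + 1, which avoids square roots; summing over all f gives one
   bound for all coordinates. *)
pose M := \sum_(f : tindex E k) \sum_(S : {set 'I_k}) (w f S + 1).
exists M => B sB Bc i.
have w_ge (f : tindex E k) (S : {set 'I_k}) :
    tdot J (B i) (tpow k (dual_point v f S)) ^+ 2 <= w f S.
  set x := dual_point v f S.
  apply: (@le_trans _ _ (tdot J (\sum_i tsquare (B i)) (tpow (k + k) x))).
    rewrite tdot_suml (bigD1 i) //= tdot_sym_square lerDl.
    by apply: sumr_ge0 => j _; rewrite tdot_sym_square sqr_ge0.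
  rewrite tdot_ptensr; apply: (le_trans (ler_norm _)).
  apply: (le_trans (ler_norm_sum _ _ _)); apply: ler_sum => g _.
  by rewrite normrM -normr_prod ler_wpM2r.
have w0 f S : 0 <= w f S by apply: le_trans (w_ge f S); exact: sqr_ge0.
split=> // j; rewrite in_itv /= -ler_norml.
have -> : B i ord0 j = tcoef (B i) (enum_val j) by rewrite /tcoef enum_valK.
apply: (le_trans (norm_tcoef_le hv _ (sB i))).
rewrite /M (bigD1 (enum_val j)) //= -[leLHS]addr0; apply: lerD; last first.
  by apply: sumr_ge0 => f _; apply: sumr_ge0 => S _; rewrite addr_ge0.
apply: ler_sum => S _; have := w_ge (enum_val j) S; rewrite -real_normK ?num_real //.
by have := normr_ge0 (tdot J (B i) (tpow k (dual_point v (enum_val j) S))); nra.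
Qed.

(* Only a bounded part of the cone matters near a given point, and there the
   squared tensors range over a compact set. *)
Lemma SOS_closed : closed (SOS E k).
Proof.
move=> T clT.
(* A single bound for all coordinates of the tensors close to T. *)
pose c : R := \sum_j (`|T 0 j| + 1).
have [M hM] := SOS_bounded c.
pose C := [set \sum_i t i | t in [set t : 'I_D -> tensor E (k + k) |
  forall i, (tsquare @` sym_box M) (t i)]].
have Cc : compact C.
  apply: compact_sums; apply: continuous_compact; last exact: sym_box_compact.
  apply: continuous_subspaceT; exact: tsquare_continuous.
have : closure C T.
  move=> U nU.
  have nV : \forall T' \near T, forall j : 'I_D,
      `|(T' : tensor E (k + k)) 0 j| <= `|T 0 j| + 1.
    apply: (filter_forall (f := fun (j : 'I_D) (T' : tensor E (k + k)) =>
      `|T' 0 j| <= `|T 0 j| + 1) (nbhs_filter T)) => j.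
    have nTj : nbhs (T 0 j) [set z : R | `|z| <= `|T 0 j| + 1].
      apply: filterS (nbhsx_ballx (T 0 j) 1 ltr01) => z /=.
      rewrite -ball_normE /= => Tz; have := ler_distD 0 z (T 0 j).
      by have := ler_normD (T 0 j) (z - T 0 j); rewrite subrKC distrC; lra.
    exact: (@coord_continuous R _ _ 0 j T _ nTj).
  have [T' [/SOS_sums[B sB T'E] [T'U T'c]]] := clT _ (filterI nU nV).
  exists T'; split=> //; rewrite T'E; exists (fun i => tsquare (B i)) => // i.
  exists (B i) => //; apply: hM => // f; rewrite -T'E.
  apply: (le_trans (T'c _)); rewrite /c (bigD1 (enum_rank f)) //= lerDl.
  by apply: sumr_ge0 => j _; rewrite addr_ge0.
move=> /(compact_closed _ Cc) => CT.
have [t tC <-] : C T by apply: CT; exact: norm_hausdorff.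
apply/SOS_sums.
have /choice[B BE] i : exists B, symtensor B /\ tsquare B = t i.
  by have [B [sB _] Bt] := tC i; exists B.
exists B => [i|]; first by case: (BE i).
by apply: eq_bigr => i _; case: (BE i).
Qed.

End SOSClosed.

(** * The hierarchy of cones *)

Section Hierarchy.
Variables (R : realType) (E : vectType R) (J : euclideanJordan E).
Variable v : (\dim {:E}).-tuple E.
Hypothesis hv : orthonormal_basis J v.
Local Notation n := (\dim {:E}).
Local Notation dot := (jdot J).

Let phiK : cancel (passmx.rVof v) (passmx.vecof v).
Proof. by apply: passmx.rVofK; case: hv. Qed.

Lemma psi_COP m : psi J v m @` COP J m = COPpoly J v m.
Proof.
apply/seteqP; split=> [_ [A [sA copA] <-]|theta [/hpolyP/(psi_surj hv)[A sA <-] cop]].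
  split; first by apply/hpolyP; exact: wform_psi.
  by move=> _ [x /copA xA <-]; rewrite /psi phiK.
exists A => //; split=> // x Ex; have := cop (passmx.rVof v x).
by rewrite /psi phiK; apply; exists x.
Qed.

Lemma psi_KNN m r : psi J v m @` KNN J m r = KNNpoly J v m r.
Proof.
apply/seteqP; split=> [_ [A /(KNN_sospoly hv)[_ sosA] <-]|theta knn].
  by apply/KNNpoly_psi.
have [/hpolyP/(psi_surj hv)[A sA AE] _] := knn.
exists A => //; apply/(KNN_sospoly hv); split=> //.
by apply/KNNpoly_psi; rewrite AE.
Qed.

(** The lift is linear, because [psi] is linear and injective on symmetric tensors, hence continuous
    in finite dimension; the cone is cut out by a preimage of the closed cone [SOS]. *)
Lemma KNN_closed m r : closed (KNN J m r).
Proof.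
have -> : KNN J m r =
    @symtensor R E m `&` (@lift_tensor R E J m r) @^-1` SOS E (r + m).
  by [].
apply: closedI; first exact: symtensor_closed.
apply: (@preimage_closed _ _ (@lift_tensor R E J m r) (SOS E (r + m))); last first.
  exact: SOS_closed hv (r + m)%N.
move=> A _; move: A; apply: linear_rV_continuous => c A B.
have [sL LE] := lift_tensorP hv r (c *: A + B).
have [sA AE] := lift_tensorP hv r A; have [sB BE] := lift_tensorP hv r B.
apply: (psi_inj hv) => //; first by apply: symtensorD => //; exact: symtensorZ.
by rewrite LE psi_linear AE BE lift_form_linear.
Qed.

Lemma KNN_convex m r : @convex_set R (tensor E m) (KNN J m r).
Proof.
apply/convexP => A B t t0 t1 /(KNN_sospoly hv)[sA sosA] /(KNN_sospoly hv)[sB sosB].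
apply/(KNN_sospoly hv); split; first by apply: symtensorD; exact: symtensorZ.
have /convexP := convex_preimage (@lift_form_linear _ _ J v m r)
  (@convex_hull_convex _ _ _ : @convex_set R _ (@sospoly R n (r + m))).
exact.
Qed.

Lemma KNN_cone m r : cone (KNN J m r).
Proof.
have lift_formZ (c : R) A :
    lift_form J v r (c *: A) = fun X => c * lift_form J v r A X :> R.
  apply/funext => X; rewrite /lift_form /square_form /psi tdotZl; ring.
split=> [|c A c0 /(KNN_sospoly hv)[sA sosA]].
  exists 0; apply/(KNN_sospoly hv); split; first exact: symtensor0.
  apply: (@eq_sospoly _ _ _ (fun=> 0)); last by apply: sub_convex_hull; exact: sq_hpoly0.
  by move=> X; rewrite /lift_form /square_form /psi tdot0l mulr0.
apply/(KNN_sospoly hv); split; first exact: symtensorZ.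
by rewrite lift_formZ; apply: sospolyZ => //; exact: ltW.
Qed.

Lemma KNN_subS m r : KNN J m r `<=` KNN J m r.+1.
Proof.
move=> A /(KNN_sospoly hv)[sA sosA]; apply/(KNN_sospoly hv); split=> //.
apply: (eq_sospoly _ (sospolyM_sqnorm sosA)) => X.
by rewrite /lift_form exprS mulrA.
Qed.

Lemma tpow0 m : (1 <= m)%N -> tpow m 0 = 0 :> tensor E m.
Proof.
move=> m0; apply: tensorP => f; rewrite tcoefK /tcoef mxE (bigD1 (Ordinal m0)) //=.
by rewrite linear0 mul0r.
Qed.

Lemma tdot0r m (A : tensor E m) : tdot J A 0 = 0.
Proof.
rewrite /tdot big1 // => f _; rewrite big1 // => g _.
by rewrite [tcoef 0 g]mxE mulr0 mul0r.
Qed.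

Lemma sqnorm_gt0 (X : 'rV[R]_n) : X != 0 -> 0 < \sum_i X 0 i ^+ 2.
Proof.
move=> /rV0Pn[i Xi]; rewrite (bigD1 i) //= ltr_wpDr ?exprn_even_gt0 //.
by apply: sumr_ge0 => j _; exact: sqr_ge0.
Qed.

(** Away from the origin one divides by |x|^(2r) > 0. At the origin that factor may vanish, but the
    m-th power of 0 is the zero tensor as m >= 1. *)
Lemma KNN_sub_COP m r : (1 <= m)%N -> KNN J m r `<=` COP J m.
Proof.
move=> m0 A /(KNN_sospoly hv)[sA sosA]; split=> // _ [x _ <-].
have := sospoly_ge0 (passmx.rVof v x) sosA.
rewrite /lift_form (square_formE hv) phiK.
have [x0|x0] := eqVneq (passmx.rVof v x) 0.
  have -> : x = 0 by apply/eqP; rewrite -(passmx.rVof_eq0 hv.1) x0.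
  by rewrite linear0l tpow0 // tdot0r.
by rewrite pmulr_rge0 // exprn_gt0 // sqnorm_gt0.
Qed.

Definition one_tensor m : tensor E m := tpow m (jone J).

Lemma one_tensor_sym m : symtensor (one_tensor m).
Proof. by move=> s; rewrite /one_tensor /tpow tpermute_ptens. Qed.

(** With e the identity, associativity of the inner product gives e • (x ∘ x) = (e ∘ x) • x = x •
    x. *)
Lemma tdot_one_tensor m x :
  tdot J (one_tensor m) (tpow m (jmul J x x)) = dot x x ^+ m.
Proof. by rewrite tdot_ptens prodr_const card_ord -jdotA jmul1. Qed.

Lemma COP_interior_coercive m (A : tensor E m) :
  interior (COP J m : set (symspace E m)) A ->
  exists2 t : R, 0 < t & COP J m (A - t *: one_tensor m).
Proof.
move=> iA; have [sA _] : COP J m A := interior_subset iA.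
have : nbhs A [set B | symtensor B -> COP J m B].
  have /(nbhs_subspace_ex _ sA)[V nV VE] : nbhs (A : symspace E m) (COP J m) := iA.
  apply: filterS nV => B VB sB.
  by have : (V `&` @symtensor R E m) B by []; rewrite -VE => -[].
move=> /nbhs_ballP[e /= e0 Ae].
(* Half the radius keeps the perturbed tensor strictly inside the ball; the added 1 keeps the
   denominator positive. *)
pose t : R := e / 2 / (`|one_tensor m| + 1).
have d0 : 0 < `|one_tensor m| + 1 by rewrite ltr_wpDl.
have t0 : 0 < t by rewrite !divr_gt0.
exists t => //; apply: Ae.
  rewrite -ball_normE /= opprB addrC subrK normrZ gtr0_norm //.
  apply: (@le_lt_trans _ _ (e / 2)); last by lra.
  rewrite /t -(mulrA (e / 2)) ler_piMr //; first by rewrite divr_ge0 // ltW.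
  by rewrite mulrC ler_pdivrMr // mul1r lerDl.
rewrite -scaleNr; apply: symtensorD => //; apply: symtensorZ.
exact: one_tensor_sym.
Qed.

Lemma interior_COP_sub m :
  interior (COP J m : set (symspace E m)) `<=` \bigcup_r KNN J m r.
Proof.
move=> A iA; have [sA _] : COP J m A := interior_subset iA.
have [t t0 [_ At]] := COP_interior_coercive iA.
have [|r sosr] := reznick (wform_square_form hv A).
  (* Copositivity of A - t e^{⊗m} says that the form of A is at least t |X|^(2m), which is positive
     here. *)
  move=> X X0; rewrite (square_formE hv); set x := passmx.vecof v X.
  have := At _ (imageP (fun x => jmul J x x) (I : setT x)).
  rewrite -scaleNr tdotDl tdotZl tdot_one_tensor mulNr subr_ge0.
  apply: lt_le_trans; rewrite mulr_gt0 // exprn_gt0 //.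
  by rewrite (dot_sqnorm hv) sqnorm_gt0.
by exists r => //; apply/(KNN_sospoly hv).
Qed.

End Hierarchy.

Theorem theorem3p4 (R : realType) (E : vectType R) (J : euclideanJordan E)
    (v : (\dim {:E}).-tuple E) (hv : orthonormal_basis J v)
    (m : nat) (hm : (1 <= m)%N) :
  [/\ psi J v m @` COP J m = COPpoly J v m,
      forall r : nat, psi J v m @` KNN J m r = KNNpoly J v m r
    & [/\ forall r : nat,
            [/\ closed (KNN J m r : set (symspace E m)),
                convex_set (KNN J m r : set (convex_lmodType (tensor E m)))
              & cone (KNN J m r)],
          forall r : nat,
            KNN J m r `<=` KNN J m r.+1 /\ KNN J m r.+1 `<=` COP J m
        & interior (COP J m : set (symspace E m))
            `<=` \bigcup_(r in [set: nat]) KNN J m r]].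
Proof.
split; [exact: (psi_COP hv m) | exact: (psi_KNN hv m) | split=> [r|r|]].
- split; last exact: KNN_cone hv m r.
    by apply: closed_subspaceW; exact: KNN_closed hv m r.
  exact: KNN_convex hv m r.
- by split; [exact: KNN_subS hv m r | exact: KNN_sub_COP hv m r.+1 hm].
- exact: interior_COP_sub hv m.
Qed.
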